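(* Let $\mathcal{X}$ be a finite set, $\mathcal{B}$ a finite-dimensional Hilbert space, and $x\mapsto\rho_x$ a classical-quantum channel with density matrices $\rho_x$ on $\mathcal{B}$. Let $p_X$ be a distribution on $\mathcal{X}$ and $\rho^{XB}=\sum_xp_X(x)|x\rangle\langle x|\otimes\rho_x$. For every rate $R<I(X:B)_\rho$ and every $\eta>0$ there exist $\delta\in(0,1/64)$ and a positive integer $n$ such that the following coding scheme over $n$ independent uses of the channel, with $M=\lfloor 2^{nR}\rfloor$ messages, has expected (over the random codebook) average decoding error probability at most $\eta$. Encoding: for each message $m\in\{1,\ldots,M\}$ choose a codeword $x^n(m)\in\mathcal{X}^n$ independently according to the i.i.d. distribution $p_X^{\otimes n}$; sending $m$ produces the state $\rho_{x^n(m)}$. Decoding: for $x^n\in T^{X^n}_\delta$ let $\Pi_{x^n}:=\Pi^{\rho_{x^n}}_\delta$ and for $x^n\notin T^{X^n}_\delta$ let $\Pi_{x^n}:=0$. On receiving a state, for $m=1,2,\ldots,M$ in turn, perform the two-outcome projective measurement $\{\Pi_{x^n(m)},I-\Pi_{x^n(m)}\}$ on the current (post-measurement) state; if the outcome is $\Pi_{x^n(m)}$, stop and output $m$, otherwise proceed to $m+1$; if all $M$ measurements fail, abort (counted as an error).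
   Context: Logarithms are base 2; $I(X:B)_\rho$ is the quantum mutual information of $\rho^{XB}$. $\rho_{x^n}:=\rho_{x_1}\otimes\cdots\otimes\rho_{x_n}$. Typical set: $T^{X^n}_\delta:=\{x^n:\forall x,\ |N(x|x^n)/n-p_X(x)|\le\delta p_X(x)\}$ with $N(x|x^n)$ the number of occurrences of $x$ in $x^n$. For a density matrix $\sigma=\sum_sq(s)|s\rangle\langle s|$ in a fixed eigenbasis, the typical projector $\Pi^{\sigma^n}_\delta$ projects onto the span of basis vectors $|s_1\cdots s_N\rangle$ with $|N(s|s^N)/N-q(s)|\le\delta q(s)$ for all $s$. The conditionally typical projector is $\Pi^{\rho_{x^n}}_\delta:=\bigotimes_{x\in\mathcal{X}}\Pi^{\rho_x^{\otimes N(x|x^n)}}_\delta$, where the factor for $x$ acts on the positions $i$ with $x_i=x$. The average error probability of a codebook is $M^{-1}\sum_m\Pr[\text{decoder output}\ne m\mid m\text{ sent}]$. *)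

(* Defs.v *)
(* MathComp + MathComp-Analysis (ln, powR) + real_closed complex + spectral. *)
From HB Require Import structures.
From mathcomp Require Import all_boot all_order all_algebra.
From mathcomp Require Import complex.
From mathcomp Require Import sesquilinear spectral.
From mathcomp Require Import reals exp.

Set Implicit Arguments.
Unset Strict Implicit.
Unset Printing Implicit Defensive.

Import Order.TTheory GRing.Theory Num.Theory.
Local Open Scope ring_scope.
Local Open Scope sesquilinear_scope.

Section QDefs.
Variable R : realType.
(* the complex numbers over R *)
Local Notation C := (R[i]).

(* base-2 logarithm *)
Definition log2 (t : R) : R := ln t / ln 2.
(* t log2 t with the convention 0 log 0 = 0 *)
Definition xlog2x (t : R) : R := if t == 0 then 0 else t * log2 t.

(* density matrices: Hermitian, positive semidefinite, trace one *)
Definition is_density n (A : 'M[C]_n) : Prop :=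
  [/\ A \is hermsymmx,
      (forall u : 'rV[C]_n, 0 <= (u *m A *m u ^t*) 0 0) &
      \tr A = 1].

(* von Neumann entropy (base 2) via the eigenvalues supplied by the spectral
   theorem of mathcomp (spectral_diag A lists the eigenvalues of a normal A) *)
Definition vN_entropy n (A : 'M[C]_n) : R :=
  - \sum_(i < n) xlog2x (complex.Re (spectral_diag A 0 i)).

(* operator on C^T (T a finite type) given by its matrix entries *)
Definition mxof (T : finType) (f : T -> T -> C) : 'M[C]_#|{: T}| :=
  \matrix_(i, j) f (enum_val i) (enum_val j).

(* entry of an operator on C^T at basis labels u, v *)
Definition entry (T : finType) (A : 'M[C]_#|{: T}|) (u v : T) : C :=
  A (enum_rank u) (enum_rank v).

(* partial traces of an operator on C^A (x) C^B = C^(A * B) *)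
Definition ptrB (A B : finType) (s : 'M[C]_#|{: A * B}|) : 'M[C]_#|{: A}| :=
  mxof (fun a a' : A => \sum_(b : B) entry s (a, b) (a', b)).
Definition ptrA (A B : finType) (s : 'M[C]_#|{: A * B}|) : 'M[C]_#|{: B}| :=
  mxof (fun b b' : B => \sum_(a : A) entry s (a, b) (a, b')).

(* quantum mutual information I(A:B)_s = S(A) + S(B) - S(AB) *)
Definition qmutinf (A B : finType) (s : 'M[C]_#|{: A * B}|) : R :=
  vN_entropy (ptrB s) + vN_entropy (ptrA s) - vN_entropy s.

(* the cq state rho^{XB} = sum_x p(x) |x><x| (x) rho_x *)
Definition cq_state (X : finType) d (p : X -> R) (rho : X -> 'M[C]_d)
  : 'M[C]_#|{: X * 'I_d}| :=
  mxof (fun u v : X * 'I_d =>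
          if u.1 == v.1 then ((p u.1)%:C)%C * rho u.1 u.2 v.2 else 0).

(* n-fold tensor power: basis labels of (C^d)^{(x) n} are functions 'I_n -> 'I_d *)
Definition nbasis n d := {ffun 'I_n -> 'I_d}.

(* rho_{x^n} = rho_{x_1} (x) ... (x) rho_{x_n} *)
Definition prod_state (X : finType) d n (rho : X -> 'M[C]_d)
  (xn : {ffun 'I_n -> X}) : 'M[C]_#|{: nbasis n d}| :=
  mxof (fun a b : nbasis n d => \prod_(k < n) rho (xn k) (a k) (b k)).

(* N(x|x^n) *)
Definition Nocc (X : finType) n (xn : {ffun 'I_n -> X}) (x : X) : nat :=
  #|[set k | xn k == x]|.

(* typical set T^{X^n}_delta *)
Definition typical (X : finType) n (p : X -> R) (delta : R)
  (xn : {ffun 'I_n -> X}) : bool :=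
  [forall x, `|(Nocc xn x)%:R / n%:R - p x| <= delta * p x].

(* eigen-label sequence s^n is conditionally typical for x^n: for every x,
   the subsequence of s at positions {k | x_k = x} (of length N := N(x|x^n))
   satisfies |N(t|.) - N q_x(t)| <= delta q_x(t) N for all labels t
   (i.e. |N(t|.)/N - q_x(t)| <= delta q_x(t) when N > 0; the empty
   subsequence is typical, the typical projector on zero systems being 1). *)
Definition cond_typical (X : finType) d n (q : X -> 'I_d -> R) (delta : R)
  (xn : {ffun 'I_n -> X}) (s : nbasis n d) : bool :=
  [forall x, forall t : 'I_d,
     `|(#|[set k | (xn k == x) && (s k == t)]|)%:R - (Nocc xn x)%:R * q x t|
       <= delta * q x t * (Nocc xn x)%:R].

(* conditionally typical projector Pi^{rho_{x^n}}_delta, where the fixed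
   eigenbasis of rho_x is given by the columns of the unitary U x, with
   eigenvalue q x t for the column t: it is the projector onto the span of the
   orthonormal product vectors |u_{s_1}^{x_1} ... u_{s_n}^{x_n}> over the
   conditionally typical s^n *)
Definition cond_typ_proj (X : finType) d n (U : X -> 'M[C]_d)
  (q : X -> 'I_d -> R) (delta : R) (xn : {ffun 'I_n -> X})
  : 'M[C]_#|{: nbasis n d}| :=
  mxof (fun a b : nbasis n d =>
    \sum_(s : nbasis n d | cond_typical q delta xn s)
       \prod_(k < n) (U (xn k) (a k) (s k) * (U (xn k) (b k) (s k))^*)).

(* decoding projector Pi_{x^n} *)
Definition dec_proj (X : finType) d n (p : X -> R) (U : X -> 'M[C]_d)
  (q : X -> 'I_d -> R) (delta : R) (xn : {ffun 'I_n -> X})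
  : 'M[C]_#|{: nbasis n d}| :=
  if typical p delta xn then cond_typ_proj U q delta xn else 0.

(* probability that the sequential decoder outputs m when the state sg is
   received: Tr(Pi_m Q_{m-1} ... Q_0 sg Q_0 ... Q_{m-1} Pi_m),
   with Q_k = I - Pi_k, measurements performed for messages 0, 1, ..., m *)
Definition seq_dec_prob D M (P : 'I_M -> 'M[C]_D) (sg : 'M[C]_D) (m : 'I_M) : R :=
  let F := foldr (fun (k : 'I_M) (A : 'M[C]_D) => A *m (1%:M - P k)) 1%:M
                 (filter (fun k : 'I_M => (k < m)%N) (enum 'I_M)) in
  let G := P m *m F in
  complex.Re (\tr (G *m sg *m G ^t*)).

(* average error probability of a codebook c *)
Definition avg_error (X : finType) d n M (p : X -> R) (rho : X -> 'M[C]_d)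
  (U : X -> 'M[C]_d) (q : X -> 'I_d -> R) (delta : R)
  (c : {ffun 'I_M -> {ffun 'I_n -> X}}) : R :=
  M%:R^-1 * \sum_(m < M)
     (1 - seq_dec_prob (fun k => dec_proj p U q delta (c k))
                       (prod_state rho (c m)) m).

(* probability of codebook c under i.i.d. p^{(x) n} codewords, independent
   across messages *)
Definition codebook_prob (X : finType) n M (p : X -> R)
  (c : {ffun 'I_M -> {ffun 'I_n -> X}}) : R :=
  \prod_(m < M) \prod_(k < n) p (c m k).

(* expected (over the random codebook) average error probability *)
Definition expected_error (X : finType) d n M (p : X -> R)
  (rho : X -> 'M[C]_d) (U : X -> 'M[C]_d) (q : X -> 'I_d -> R) (delta : R) : R :=
  \sum_(c : {ffun 'I_M -> {ffun 'I_n -> X}})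
     codebook_prob p c * avg_error p rho U q delta c.

End QDefs.

(* Main.v *)
(** Writing each signal state as [sigma = S S^*], the sequential decoder succeeds
    with probability [||G S||^2] in Hilbert-Schmidt norm, where [G] is the product of
    the projections that have to occur. A non-commutative union bound, proved by one
    application of Pythagoras per measurement, controls [||S - G S||^2] by
    [||(1 - P_m) S||^2 + sum_(k < m) ||P_k S||^2]. The decoder does not test the
    typical subspace of the average state, but the analysis may: [S] is first replaced
    by [E S], where [E] projects onto the eigenvectors of [rhobar^(x)n] of eigenvalue
    at most [2^(-n (S(rhobar) - c))]. All resulting terms are linear in the code, so
    averaging gives (i) two probabilities of atypicality, of order [1/n] by Chebyshev,
    and (ii) [M tr(P E rhobar^(x)n E P) <= M 2^(-n (S(rhobar) - c)) tr P], where [tr P]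
    counts conditionally typical sequences; (ii) decays when the rate is below the
    Holevo quantity, which is the mutual information of the cq state. *)

Require Import Defs.
From HB Require Import structures.
From mathcomp Require Import all_boot all_order all_algebra.
From mathcomp Require Import complex.
From mathcomp Require Import sesquilinear spectral.
From mathcomp Require Import reals exp.
From mathcomp Require Import ring lra.
Import Order.TTheory GRing.Theory Num.Theory.
Local Open Scope ring_scope.
Local Open Scope sesquilinear_scope.

Set Implicit Arguments.
Unset Strict Implicit.

(** * Independent letters *)

Lemma sum_prod_ffun (K : comPzRingType) (I T : finType) (F : I -> T -> K) :
  \sum_(s : {ffun I -> T}) \prod_i F i (s i) = \prod_i \sum_t F i t.
Proof. by rewrite bigA_distr_bigA. Qed.

Section ProductWeights.
Variables (R : realType) (I T : finType) (w : T -> R).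
Hypothesis w_sum : \sum_t w t = 1.

Lemma sum_prod_weight : \sum_(s : {ffun I -> T}) \prod_i w (s i) = 1.
Proof. by rewrite (sum_prod_ffun (fun=> w)) big1. Qed.

Lemma marginal1 (i : I) (f : T -> R) :
  \sum_(s : {ffun I -> T}) (\prod_j w (s j)) * f (s i) = \sum_t w t * f t.
Proof.
under eq_bigr => s _.
  rewrite (_ : _ * _ = \prod_j (w (s j) * if j == i then f (s j) else 1)); last first.
    rewrite big_split /=; congr (_ * _); rewrite (bigD1 i) //= eqxx big1 ?mulr1 //.
    by move=> j /negPf->.
  over.
rewrite (sum_prod_ffun (fun j t => w t * if j == i then f t else 1)) /=.
rewrite (bigD1 i) //= eqxx [X in _ * X]big1 ?mulr1 // => j /negPf->.
by under eq_bigr do rewrite mulr1.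
Qed.

(** Splitting [f (s i) (s j)] according to the values at [i] and [j] turns each term into a product
    over coordinates, and such sums factorize. *)
Lemma marginal2 (i j : I) (f : T -> T -> R) : i != j ->
  \sum_(s : {ffun I -> T}) (\prod_k w (s k)) * f (s i) (s j)
  = \sum_x \sum_y w x * w y * f x y.
Proof.
move=> neq_ij; have neq_ji : (j == i) = false by rewrite eq_sym (negPf neq_ij).
(* [e x y] inserts the indicator of [x] at coordinate [i] and that of [y] at coordinate [j];
   elsewhere it is the plain weight. *)
pose e x y k t := w t * (if k == i then (t == x)%:R else 1)
                     * (if k == j then (t == y)%:R else 1) : R.
transitivity (\sum_x \sum_y (\sum_(s : {ffun I -> T}) \prod_k e x y k (s k)) * f x y).
  transitivity (\sum_(s : {ffun I -> T}) \sum_x \sum_y (\prod_k e x y k (s k)) * f x y);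
    last first.
    rewrite exchange_big; apply: eq_bigr => x _; rewrite exchange_big.
    by apply: eq_bigr => y _; rewrite mulr_suml.
  apply: eq_bigr => s _.
  have E x y : \prod_k e x y k (s k) =
      (\prod_k w (s k)) * (s i == x)%:R * (s j == y)%:R.
    rewrite !big_split /= -!mulrA; congr (_ * (_ * _)).
      by rewrite (bigD1 i) //= eqxx big1 ?mulr1 // => k /negPf->.
    by rewrite (bigD1 j) //= eqxx big1 ?mulr1 // => k /negPf->.
  rewrite (bigD1 (s i)) //= [X in _ + X]big1 ?addr0 => [|x nx]; last first.
    by apply: big1 => y _; rewrite E [s i == x]eq_sym (negPf nx) mulr0 !mul0r.
  rewrite (bigD1 (s j)) //= [X in _ + X]big1 ?addr0 => [|y ny]; last first.
    by rewrite E [s j == y]eq_sym (negPf ny) mulr0 mul0r.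
  by rewrite E !eqxx !mulr1.
apply: eq_bigr => x _; apply: eq_bigr => y _; congr (_ * _).
have delta (z : T) : \sum_t w t * (t == z)%:R = w z.
  rewrite (bigD1 z) //= eqxx mulr1 big1 ?addr0 // => t /negPf->.
  by rewrite mulr0.
rewrite (sum_prod_ffun (e x y)) (bigD1 i) //= (bigD1 j) ?neq_ji //= [X in _ * (_ * X)]big1.
  rewrite /e !eqxx (negPf neq_ij) neq_ji mulr1.
  under eq_bigr do rewrite mulr1.
  by under [X in _ * X]eq_bigr do rewrite mulr1; rewrite !delta.
move=> k /andP[/negPf ki /negPf kj]; rewrite /e ki kj.
by under eq_bigr do rewrite !mulr1.
Qed.

Hypothesis w_ge0 : forall t, 0 <= w t.

Lemma prod_weight_ge0 (s : {ffun I -> T}) : 0 <= \prod_i w (s i).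
Proof. by apply: prodr_ge0. Qed.

(** The square expands into pairs of coordinates; off the diagonal the two factors are independent
    and centred, so only the diagonal survives. *)
Lemma variance_sum (g : T -> R) : \sum_t w t * g t = 0 ->
  \sum_(s : {ffun I -> T}) (\prod_i w (s i)) * (\sum_i g (s i)) ^+ 2
  = #|I|%:R * \sum_t w t * g t ^+ 2.
Proof.
move=> g0.
transitivity (\sum_i \sum_j \sum_(s : {ffun I -> T})
    (\prod_k w (s k)) * (g (s i) * g (s j))).
  under [RHS]eq_bigr => i _ do rewrite exchange_big.
  rewrite exchange_big /=; apply: eq_bigr => s _.
  rewrite expr2 mulr_suml mulr_sumr; apply: eq_bigr => i _.
  by rewrite mulrA !mulr_sumr; apply: eq_bigr => j _; rewrite mulrA.
rewrite mulr_natl -sumr_const; apply: eq_bigr => i _.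
rewrite (bigD1 i) //= [X in _ + X]big1 => [|j ji].
  by rewrite addr0 (marginal1 i (fun t => g t * g t)); apply: eq_bigr => t _; rewrite expr2.
rewrite (marginal2 (fun x y => g x * g y)) 1?eq_sym //.
apply: big1 => x _; transitivity (w x * g x * \sum_y w y * g y); last by rewrite g0 mulr0.
by rewrite mulr_sumr; apply: eq_bigr => y _; ring.
Qed.

Lemma chebyshev (g : T -> R) (tau : R) : \sum_t w t * g t = 0 -> 0 < tau ->
  (0 < #|I|)%N ->
  \sum_(s : {ffun I -> T} | #|I|%:R * tau < `|\sum_i g (s i)|) \prod_i w (s i)
  <= (\sum_t w t * g t ^+ 2) / tau ^+ 2 / #|I|%:R.
Proof.
move=> g0 tau0 I0; set n : R := #|I|%:R.
have n0 : 0 < n by rewrite ltr0n.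
have nt : 0 < (n * tau) ^+ 2 by rewrite exprn_gt0 ?mulr_gt0.
have -> : (\sum_t w t * g t ^+ 2) / tau ^+ 2 / n
        = (n * \sum_t w t * g t ^+ 2) / (n * tau) ^+ 2.
  by field; rewrite !gt_eqF.
rewrite ler_pdivlMr // -variance_sum // mulr_suml big_mkcond /=.
apply: ler_sum => s _; case: ifP => [lt_s|_].
  apply: ler_wpM2l; first exact: prod_weight_ge0.
  rewrite -[leRHS]real_normK ?num_real // ler_pXn2r ?nnegrE ?normr_ge0 //; first by apply: ltW.
  by rewrite mulr_ge0 ?ltW.
by rewrite mulr_ge0 ?sqr_ge0 ?prod_weight_ge0.
Qed.

End ProductWeights.

(** * The non-commutative union bound *)

Section HilbertSchmidt.
Variable R : realType.
Local Notation C := R[i].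

Lemma ReD (x y : C) : complex.Re (x + y) = complex.Re x + complex.Re y.
Proof. by case: x y => [a b] [c e]. Qed.

Lemma Re_sum (I : Type) (r : seq I) (P : pred I) (F : I -> C) :
  complex.Re (\sum_(i <- r | P i) F i) = \sum_(i <- r | P i) complex.Re (F i).
Proof. exact: (big_morph _ ReD). Qed.

Lemma ReB (x y : C) : complex.Re (x - y) = complex.Re x - complex.Re y.
Proof. by case: x y => [a b] [c e]. Qed.

Lemma Re_scale (a : R) (x : C) : complex.Re ((a%:C)%C * x) = a * complex.Re x.
Proof. by case: x => b c /=; rewrite mul0r subr0. Qed.

Lemma Re_mul_conj (x : C) :
  complex.Re (x * x^*) = complex.Re x ^+ 2 + complex.Im x ^+ 2.
Proof. by case: x => a b /=; rewrite mulrN opprK !expr2. Qed.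

Lemma adj_mul m n k (A : 'M[C]_(m, n)) (B : 'M[C]_(n, k)) :
  (A *m B) ^t* = B ^t* *m A ^t*.
Proof. by rewrite trmx_mul map_mxM. Qed.

(** The square of the Hilbert-Schmidt norm: in this form Pythagoras is additive and measurement
    probabilities are themselves values of it. *)
Definition hsnorm m n (A : 'M[C]_(m, n)) : R := complex.Re (\tr (A *m A ^t*)).

Lemma hsnormE m n (A : 'M[C]_(m, n)) :
  hsnorm A = \sum_i \sum_j (complex.Re (A i j) ^+ 2 + complex.Im (A i j) ^+ 2).
Proof.
rewrite /hsnorm /mxtrace Re_sum; apply: eq_bigr => i _.
by rewrite mxE Re_sum; apply: eq_bigr => j _; rewrite !mxE Re_mul_conj.
Qed.

Lemma hsnorm_ge0 m n (A : 'M[C]_(m, n)) : 0 <= hsnorm A.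
Proof. by rewrite hsnormE; do 2![apply: sumr_ge0 => ? _]; rewrite addr_ge0 ?sqr_ge0. Qed.

Lemma hsnormN m n (A : 'M[C]_(m, n)) : hsnorm (- A) = hsnorm A.
Proof. by rewrite /hsnorm linearN /= map_mxN mulmxN mulNmx opprK. Qed.

(** Young's inequality on every real and imaginary part. The free weight [a] allows the first
    coefficient to be arbitrarily close to 1. *)
Lemma hsnormD m n (A B : 'M[C]_(m, n)) (a : R) : 0 < a ->
  hsnorm (A + B) <= (1 + a) * hsnorm A + (1 + a^-1) * hsnorm B.
Proof.
move=> a0; rewrite !hsnormE !mulr_sumr -big_split /=; apply: ler_sum => i _.
rewrite !mulr_sumr -big_split /=; apply: ler_sum => j _; rewrite !mxE ReD.
have -> : complex.Im (A i j + B i j) = complex.Im (A i j) + complex.Im (B i j).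
  by case: (A i j) (B i j) => [? ?] [? ?].
have young (x y : R) : (x + y) ^+ 2 <= (1 + a) * x ^+ 2 + (1 + a^-1) * y ^+ 2.
  rewrite -subr_ge0.
  have -> : (1 + a) * x ^+ 2 + (1 + a^-1) * y ^+ 2 - (x + y) ^+ 2
          = (a * x - y) ^+ 2 / a by field; rewrite gt_eqF.
  by rewrite divr_ge0 ?sqr_ge0 ?ltW.
have := young (complex.Re (A i j)) (complex.Re (B i j)).
have := young (complex.Im (A i j)) (complex.Im (B i j)).
by rewrite !mulrDr; lra.
Qed.

Lemma hsnormD2 m n (A B : 'M[C]_(m, n)) :
  hsnorm (A + B) <= 2 * hsnorm A + 2 * hsnorm B.
Proof. by have := hsnormD A B (@ltr01 R); rewrite invr1. Qed.

Definition is_proj n (P : 'M[C]_n) : Prop := P ^t* = P /\ P *m P = P.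

Lemma is_projC n (P : 'M[C]_n) : is_proj P -> is_proj (1%:M - P).
Proof.
move=> [Ph Pi]; split; first by rewrite linearB /= trmx1 map_mxB map_mx1 Ph.
by rewrite mulmxBl mul1mx mulmxBr mulmx1 Pi subrr subr0.
Qed.

(** The right-hand side is linear in the state [S *m S ^t*]; this is what later allows averaging
    over the code. *)
Lemma hsnorm_proj n k (P : 'M[C]_n) (S : 'M[C]_(n, k)) : is_proj P ->
  hsnorm (P *m S) = complex.Re (\tr (P *m (S *m S ^t*))).
Proof.
move=> [Ph Pi]; rewrite /hsnorm adj_mul Ph -!mulmxA mxtrace_mulC -!mulmxA Pi.
by rewrite mulmxA mxtrace_mulC.
Qed.

Lemma hsnorm_pythagoras n k (P : 'M[C]_n) (S : 'M[C]_(n, k)) : is_proj P ->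
  hsnorm (P *m S) + hsnorm ((1%:M - P) *m S) = hsnorm S.
Proof.
move=> Pp; rewrite !hsnorm_proj //; last exact: is_projC.
by rewrite -ReD -linearD /= -mulmxDl addrC subrK mul1mx.
Qed.

Lemma hsnorm_proj_le n k (P : 'M[C]_n) (S : 'M[C]_(n, k)) : is_proj P ->
  hsnorm (P *m S) <= hsnorm S.
Proof. by move=> Pp; rewrite -(hsnorm_pythagoras S Pp) lerDl hsnorm_ge0. Qed.

(** In this fold the head of the list is the rightmost factor and acts first. Pulling [B] out lets
    the last measurement be split off on the left. *)
Lemma foldr_mulmx n (K : Type) (Q : K -> 'M[C]_n) (B : 'M[C]_n) l :
  foldr (fun k A => A *m Q k) B l = B *m foldr (fun k A => A *m Q k) 1%:M l.
Proof. by elim: l => [|k l IH] /=; rewrite ?mulmx1 // IH mulmxA. Qed.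

Section SequentialMeasurement.
Variables (n : nat) (K : Type) (P : K -> 'M[C]_n).
Hypothesis Pproj : forall k, is_proj (P k).

Let seqQ := foldr (fun k A => A *m (1%:M - P k)) 1%:M.

Lemma seqQ_rcons l k : seqQ (rcons l k) = (1%:M - P k) *m seqQ l.
Proof. by rewrite /seqQ -cats1 foldr_cat /= mul1mx foldr_mulmx. Qed.

Lemma hsnorm_seqQ_le m (S : 'M[C]_(n, m)) l : hsnorm (seqQ l *m S) <= hsnorm S.
Proof.
elim/last_ind: l => [|l k IH]; first by rewrite /seqQ /= mul1mx.
rewrite seqQ_rcons -mulmxA; apply: le_trans IH.
exact/hsnorm_proj_le/is_projC.
Qed.

(** Pythagoras for [S - Q *m T]: its component under [1 - Q] no longer contains [T], and its
    component under [Q] is [Q *m (S - T)], which is no longer than [S - T]. *)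
Lemma noncommutative_union_step m (S T : 'M[C]_(n, m)) (Q : 'M[C]_n) : is_proj Q ->
  hsnorm (S - Q *m T) <= hsnorm ((1%:M - Q) *m S) + hsnorm (S - T).
Proof.
move=> Qp; have [_ Qi] := Qp; rewrite -(hsnorm_pythagoras (S - Q *m T) Qp) addrC lerD //.
  by rewrite le_eqVlt (_ : _ *m _ = (1%:M - Q) *m S) ?eqxx // mulmxBr
      [(1%:M - Q) *m (Q *m T)]mulmxA (mulmxBl 1%:M Q Q) mul1mx Qi subrr mul0mx subr0.
by rewrite (_ : _ *m _ = Q *m (S - T)) ?hsnorm_proj_le // !mulmxBr mulmxA Qi.
Qed.

Lemma noncommutative_union_bound m (S : 'M[C]_(n, m)) l :
  hsnorm (S - seqQ l *m S) <= \sum_(k <- l) hsnorm (P k *m S).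
Proof.
elim/last_ind: l => [|l k IH].
  by rewrite /seqQ /= mul1mx subrr big_nil /hsnorm mul0mx mxtrace0.
rewrite seqQ_rcons -mulmxA big_rcons /=.
(* The required outcome of the last measurement is [1 - P k], whose complement [P k] gives the new
   summand. *)
apply: le_trans (noncommutative_union_step _ _ (is_projC (Pproj k))) _.
by rewrite subKr addrC lerD.
Qed.

(* The projector [E] enters only the analysis: the received state [S S^*] is
   replaced by its compression [E S], at the price of the first term. *)
Lemma sequential_error m (S : 'M[C]_(n, m)) (E : 'M[C]_n) k l (a : R) :
  is_proj E -> 0 < a -> hsnorm S = 1 ->
  1 - hsnorm (P k *m seqQ l *m S) <= a + (1 + a^-1) *
    (12 * hsnorm ((1%:M - E) *m S) + 4 * hsnorm ((1%:M - P k) *m S)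
     + 2 * \sum_(j <- l) hsnorm (P j *m (E *m S))).
Proof.
(* Here 12 is [2 * 4], from the part of [S] removed by [E], plus [2 * 2], from replacing [E *m S] by
   [S] under [1 - P k]. *)
have arith1 (x y z p s e : R) : x <= 4 * e -> y <= z + s -> z <= 2 * p + 2 * e ->
    2 * x + 2 * y <= 12 * e + 4 * p + 2 * s by lra.
have arith2 (x y z : R) : 1 <= (1 + a) * x + z -> z <= y -> a * x <= a -> 1 - x <= a + y.
  by rewrite mulrDl mul1r; lra.
move=> Ep a0 S1.
set G := P k *m seqQ l; set e := hsnorm ((1%:M - E) *m S).
have Gle (T : 'M[C]_(n, m)) : hsnorm (G *m T) <= hsnorm T.
  rewrite -mulmxA; apply: le_trans (hsnorm_seqQ_le _ l); exact: hsnorm_proj_le.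
(* The defect [S - G *m S] is separated into the defect on the part outside [E] and the defect on
   [E *m S]; only the latter goes through the union bound. *)
have split_S : S = G *m S + ((S - E *m S) - G *m (S - E *m S) + (E *m S - G *m (E *m S))).
  by rewrite mulmxBr; apply/matrixP => i j; rewrite !mxE; ring.
have dS : S - E *m S = (1%:M - E) *m S by rewrite mulmxBl mul1mx.
have union : hsnorm (E *m S - G *m (E *m S)) <=
    hsnorm ((1%:M - P k) *m (E *m S)) + \sum_(j <- l) hsnorm (P j *m (E *m S)).
  rewrite -mulmxA; apply: le_trans (noncommutative_union_step _ _ (Pproj k)) _.
  by rewrite lerD2l noncommutative_union_bound.
have PE : hsnorm ((1%:M - P k) *m (E *m S)) <= 2 * hsnorm ((1%:M - P k) *m S) + 2 * e.
  have -> : (1%:M - P k) *m (E *m S)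
          = (1%:M - P k) *m S + - ((1%:M - P k) *m ((1%:M - E) *m S)).
    by rewrite -mulmxBr -dS subKr.
  apply: le_trans (hsnormD2 _ _) _; rewrite hsnormN lerD2l ler_wpM2l //.
  exact/hsnorm_proj_le/is_projC.
have ES : hsnorm ((S - E *m S) - G *m (S - E *m S)) <= 4 * e.
  rewrite dS; apply: le_trans (hsnormD2 _ _) _; rewrite hsnormN.
  have -> : 4 * e = 2 * e + 2 * e by rewrite -mulrDl -natrD.
  by rewrite lerD2l ler_wpM2l // Gle.
set rest := _ + (E *m S - _) in split_S.
have rest_le : hsnorm rest <= 12 * e + 4 * hsnorm ((1%:M - P k) *m S)
     + 2 * \sum_(j <- l) hsnorm (P j *m (E *m S)).
  exact: le_trans (hsnormD2 _ _) (arith1 _ _ _ _ _ _ ES union PE).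
(* Young's inequality with weight [a] bounds [hsnorm S = 1] by [(1 + a) * hsnorm (G *m S)] plus the
   remainder, and since [G] is a contraction the excess is at most [a]. *)
apply: arith2; first by have := hsnormD (G *m S) rest a0; rewrite -split_S S1; apply.
  by rewrite ler_wpM2l // addr_ge0 // invr_ge0 ltW.
by apply: ler_piMr; [exact: ltW|rewrite -[leRHS]S1; exact: Gle].
Qed.
End SequentialMeasurement.
End HilbertSchmidt.

(** * Operators with a given eigenbasis *)

Section SpectralOperators.
Variable R : realType.
Local Notation C := R[i].
Local Notation "x %:C" := (real_complex R x).

Lemma sum_enum_val (V : nmodType) (T : finType) (F : T -> V) :
  \sum_(i < #|{: T}|) F (enum_val i) = \sum_t F t.
Proof.
rewrite (reindex _ (onW_bij _ (enum_rank_bij T))) /=.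
by apply: eq_bigr => t _; rewrite enum_rankK.
Qed.

Lemma conj_prod (I : finType) (F : I -> C) : (\prod_i F i)^* = \prod_i (F i)^*.
Proof. exact: (rmorph_prod Num.conj). Qed.

Lemma real_prod (I : finType) (F : I -> R) : (\prod_i F i)%:C = \prod_i (F i)%:C.
Proof. exact: (rmorph_prod (real_complex R)). Qed.

Section Mxof.
Variable T : finType.
Implicit Types f g : T -> T -> C.

Lemma eq_mxof f g : (forall a b, f a b = g a b) -> mxof f = mxof g.
Proof. by move=> fg; apply/matrixP => i j; rewrite !mxE fg. Qed.

Lemma mxof_mul f g : mxof f *m mxof g = mxof (fun a b => \sum_c f a c * g c b).
Proof.
apply/matrixP => i j; rewrite !mxE -[RHS]sum_enum_val.
by apply: eq_bigr => k _; rewrite !mxE.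
Qed.

Lemma mxof_adj f : (mxof f) ^t* = mxof (fun a b => (f b a)^*).
Proof. by apply/matrixP => i j; rewrite !mxE. Qed.

Lemma mxof_tr f : \tr (mxof f) = \sum_a f a a.
Proof. by rewrite /mxtrace -[RHS]sum_enum_val; apply: eq_bigr => i _; rewrite mxE. Qed.

Lemma mxof1 : mxof (fun a b => (a == b)%:R) = 1%:M :> 'M[C]_#|{: T}|.
Proof. by apply/matrixP => i j; rewrite !mxE (inj_eq enum_val_inj). Qed.

Definition orthobasis (w : T -> T -> C) : Prop :=
  (forall s t, \sum_a (w a s)^* * w a t = (s == t)%:R) /\
  (forall a b, \sum_s w a s * (w b s)^* = (a == b)%:R).

(** For an orthonormal basis of columns [w _ s], the Hermitian operator with eigenvalue [f s] on
    column [s]. States and projectors in one eigenbasis thus become functions on labels, multiplied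
    pointwise. *)
Definition specop (w : T -> T -> C) (f : T -> R) : 'M[C]_#|{: T}| :=
  mxof (fun a b => \sum_s (f s)%:C * (w a s * (w b s)^*)).

Variable w : T -> T -> C.
Hypothesis wON : orthobasis w.
Implicit Types h : T -> R.

Lemma eq_specop h h' : h =1 h' -> specop w h = specop w h'.
Proof. by move=> hh; apply: eq_mxof => a b; apply: eq_bigr => s _; rewrite hh. Qed.

Lemma specop_adj h : (specop w h) ^t* = specop w h.
Proof.
rewrite mxof_adj; apply: eq_mxof => a b; rewrite rmorph_sum; apply: eq_bigr => s _.
by rewrite !rmorphM /= conjCK; congr (_ * _); [exact: (conjc_real (h s))|rewrite mulrC].
Qed.

Lemma specop_mul h h' : specop w h *m specop w h' = specop w (fun s => h s * h' s).
Proof.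
rewrite mxof_mul; apply: eq_mxof => a b.
transitivity (\sum_s \sum_t (h s)%:C * (h' t)%:C * (w a s * (w b t)^*) *
               \sum_c (w c s)^* * w c t).
  transitivity (\sum_c \sum_s \sum_t (h s)%:C * (h' t)%:C * (w a s * (w b t)^*) *
                  ((w c s)^* * w c t)).
    apply: eq_bigr => c _; rewrite mulr_suml; apply: eq_bigr => s _.
    by rewrite mulr_sumr; apply: eq_bigr => t _; ring.
  rewrite exchange_big; apply: eq_bigr => s _ /=; rewrite exchange_big.
  by apply: eq_bigr => t _; rewrite mulr_sumr.
apply: eq_bigr => s _; rewrite (bigD1 s) //= [X in _ + X]big1 ?addr0; last first.
  by move=> t ts; rewrite (proj1 wON) eq_sym (negPf ts) mulr0.
by rewrite (proj1 wON) eqxx mulr1 rmorphM.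
Qed.

Lemma specop_tr h : \tr (specop w h) = (\sum_s h s)%:C.
Proof.
rewrite mxof_tr exchange_big /= rmorph_sum; apply: eq_bigr => s _.
rewrite -mulr_sumr; under eq_bigr do rewrite mulrC.
by rewrite (proj1 wON) eqxx mulr1.
Qed.

Lemma specopB h h' : specop w h - specop w h' = specop w (fun s => h s - h' s).
Proof.
apply/matrixP => i j; rewrite !mxE -sumrB; apply: eq_bigr => s _.
by rewrite rmorphB mulrBl.
Qed.

Lemma specop1 : specop w (fun=> 1) = 1%:M.
Proof.
rewrite -mxof1; apply: eq_mxof => a b; rewrite -(proj2 wON).
by apply: eq_bigr => s _; rewrite mul1r.
Qed.

Lemma specop_scalar c h : specop w (fun s => c * h s) = c%:C *: specop w h.
Proof.
apply/matrixP => i j; rewrite !mxE mulr_sumr; apply: eq_bigr => s _.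
by rewrite [RHS]mulrA -(rmorphM (real_complex R)).
Qed.

Lemma specop_proj (A : pred T) : is_proj (specop w (fun s => (A s)%:R)).
Proof.
split; first exact: specop_adj.
by rewrite specop_mul; apply: eq_specop => s; case: (A s); rewrite ?mulr1 ?mulr0.
Qed.

Lemma specop_sqrt h : (forall s, 0 <= h s) ->
  specop w (fun s => Num.sqrt (h s)) *m (specop w (fun s => Num.sqrt (h s))) ^t*
  = specop w h.
Proof.
move=> h0; rewrite specop_adj specop_mul; apply: eq_specop => s.
by rewrite -expr2 sqr_sqrtr.
Qed.

Lemma hsnorm_mul_sqrt n (P : 'M[C]_(n, _)) h : (forall s, 0 <= h s) ->
  hsnorm (P *m specop w (fun s => Num.sqrt (h s)))
  = complex.Re (\tr (P *m specop w h *m P ^t*)).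
Proof. by move=> h0; rewrite /hsnorm adj_mul mulmxA -(mulmxA P) specop_sqrt. Qed.

(** The difference of the two sides is the squared norm of [P] times the square root of the
    nonnegative operator with eigenvalues [L - h s]. *)
Lemma Re_tr_specop_le n (P : 'M[C]_(n, _)) h L : (forall s, h s <= L) ->
  complex.Re (\tr (P *m specop w h *m P ^t*)) <= L * hsnorm P.
Proof.
move=> hL; rewrite -subr_ge0.
have := hsnorm_ge0 (P *m specop w (fun s => Num.sqrt (L - h s))).
rewrite hsnorm_mul_sqrt => [|s]; last by rewrite subr_ge0.
rewrite -(specopB (fun=> L)) (eq_specop (h' := fun s => L * 1)) => [|s]; last by rewrite mulr1.
rewrite specop_scalar specop1 mulmxBr mulmxBl linearB /= ReB.
by rewrite scalemx1 mul_mx_scalar -scalemxAl mxtraceZ Re_scale.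
Qed.

End Mxof.

Section Products.
Variables (n d : nat).
Local Notation T := (nbasis n d).

Lemma prod_eqb (s t : T) : \prod_k ((s k == t k)%:R : C) = (s == t)%:R.
Proof.
have [->|ne] := eqVneq s t; first by rewrite big1 // => k _; rewrite eqxx.
have /existsP[k nk] : [exists k, s k != t k].
  rewrite -negb_forall; apply: contra ne => /forallP st; apply/eqP/ffunP => k.
  exact/eqP.
by rewrite (bigD1 k) //= (negPf nk) mul0r.
Qed.

Lemma orthobasis_prod (u : 'I_n -> 'I_d -> 'I_d -> C) :
  (forall k, orthobasis (u k)) ->
  orthobasis (fun a s : T => \prod_k u k (a k) (s k)).
Proof.
move=> uON; split=> s t; rewrite -prod_eqb.
  transitivity (\sum_(a : T) \prod_k ((u k (a k) (s k))^* * u k (a k) (t k))).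
    by apply: eq_bigr => a _; rewrite big_split conj_prod.
  rewrite (sum_prod_ffun (fun k a => (u k a (s k))^* * u k a (t k))).
  by apply: eq_bigr => k _; rewrite (proj1 (uON k)).
transitivity (\sum_(a : T) \prod_k (u k (s k) (a k) * (u k (t k) (a k))^*)).
  by apply: eq_bigr => a _; rewrite big_split conj_prod.
rewrite (sum_prod_ffun (fun k a => u k (s k) a * (u k (t k) a)^*)).
by apply: eq_bigr => k _; rewrite (proj2 (uON k)).
Qed.

Lemma specop_prod (u : 'I_n -> 'I_d -> 'I_d -> C) (h : 'I_n -> 'I_d -> R) :
  mxof (fun a b : T => \prod_k \sum_t (h k t)%:C * (u k (a k) t * (u k (b k) t)^*))
  = specop (fun a s : T => \prod_k u k (a k) (s k)) (fun s => \prod_k h k (s k)).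
Proof.
apply: eq_mxof => a b.
rewrite -(sum_prod_ffun (fun k t => (h k t)%:C * (u k (a k) t * (u k (b k) t)^*))).
by apply: eq_bigr => s _; rewrite !big_split /= conj_prod real_prod.
Qed.

End Products.

Lemma unitarymx_orthobasis d (U : 'M[C]_d) : U \is unitarymx -> orthobasis U.
Proof.
move=> /unitarymxP UU; split=> s t; last first.
  by have /matrixP/(_ s t) := UU; rewrite !mxE => <-; apply: eq_bigr => i _; rewrite !mxE.
have /matrixP/(_ s t) := mulmx1C UU; rewrite !mxE => <-.
by apply: eq_bigr => i _; rewrite !mxE.
Qed.

End SpectralOperators.

(** * Entropy from a spectral decomposition *)

Lemma char_poly_conj (F : fieldType) n (P Q D : 'M[F]_n) :
  P *m Q = 1%:M -> char_poly (Q *m D *m P) = char_poly D.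
Proof.
move=> PQ; have QP := mulmx1C PQ.
rewrite /char_poly /char_poly_mx.
have -> : 'X%:M - map_mx polyC (Q *m D *m P) =
    map_mx polyC Q *m ('X%:M - map_mx polyC D) *m map_mx polyC P.
  rewrite mulmxBr mulmxBl -!map_mxM mul_mx_scalar -scalemxAl -map_mxM QP map_mx1.
  by rewrite scalemx1.
rewrite !det_mulmx mulrAC -det_mulmx -map_mxM QP map_mx1 det1 mul1r //.
Qed.

Lemma char_poly_diag (F : fieldType) n (D : 'rV[F]_n) :
  char_poly (diag_mx D) = \prod_(a <- [seq D 0 i | i : 'I_n]) ('X - a%:P).
Proof.
rewrite char_poly_trig; last first.
  by apply/is_trig_mxP => i j ij; rewrite mxE -val_eqE (ltn_eqF ij) mulr0n.
rewrite big_image /=; apply: eq_bigr => i _; by rewrite mxE eqxx.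
Qed.

Section Entropy.
Variable R : realType.
Local Notation C := R[i].
Local Notation "x %:C" := (real_complex R x).

Definition shannon (T : finType) (h : T -> R) : R := - \sum_t xlog2x (h t).

(** Both diagonalizations have the characteristic polynomial of [A], so their eigenvalues agree up
    to a permutation. Entropy can therefore be computed in any eigenbasis. *)
Lemma spectral_sum n (A : 'M[C]_n) (W : 'M[C]_n) (D : 'rV[C]_n) (g : C -> R) :
  A \is normalmx -> W \is unitarymx -> A = W *m diag_mx D *m W ^t* ->
  \sum_i g (spectral_diag A 0 i) = \sum_i g (D 0 i).
Proof.
move=> Anormal /unitarymxP WW AD.
have := char_poly_conj (diag_mx D) (mulmx1C WW); rewrite -AD.
have /orthomx_spectralP AE := Anormal; rewrite {1}AE.
rewrite (char_poly_conj _ (mulmxV (spectral_unit A))) !char_poly_diag.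
move=> /prod_XsubC_eq AD'.
have E (D' : 'rV[C]_n) : \sum_i g (D' 0 i) = \sum_(a <- [seq D' 0 i | i : 'I_n]) g a.
  by rewrite big_image.
by rewrite !E; exact: perm_big.
Qed.

Lemma specop_diag (T : finType) (w : T -> T -> C) (h : T -> R) :
  specop w h = mxof w *m diag_mx (\row_i (h (enum_val i))%:C) *m (mxof w) ^t*.
Proof.
apply/matrixP => i j; rewrite mul_mx_diag !mxE -[LHS]sum_enum_val.
by apply: eq_bigr => k _; rewrite !mxE mulrCA mulrA.
Qed.

Lemma specop_herm (T : finType) (w : T -> T -> C) (h : T -> R) :
  specop w h \is hermsymmx.
Proof. by apply/is_hermitianmxP; rewrite expr0 scale1r specop_adj. Qed.

Lemma vN_entropy_specop (T : finType) (w : T -> T -> C) (h : T -> R) :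
  orthobasis w -> vN_entropy (specop w h) = shannon h.
Proof.
move=> wON; rewrite /vN_entropy /shannon; congr (- _).
rewrite (spectral_sum (W := mxof w) (D := \row_i (h (enum_val i))%:C)
          (fun z => xlog2x (complex.Re z))).
- by rewrite -[RHS]sum_enum_val; apply: eq_bigr => i _; rewrite mxE.
- exact/hermitian_normalmx/specop_herm.
- apply/unitarymxP; rewrite mxof_adj mxof_mul -mxof1; apply: eq_mxof => a b.
  exact: (proj2 wON).
- exact: specop_diag.
Qed.

Lemma hermitian_specop (T : finType) (A : 'M[C]_#|{: T}|) : A \is hermsymmx ->
  exists w h, orthobasis w /\ A = specop w h :> 'M[C]_#|{: T}|.
Proof.
move=> Ah; set P := spectralmx A; set sp := spectral_diag A.
(* The spectral theorem places the inverse of [P] on the left of the diagonal, so the eigenvectors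
   are the columns of [P ^t*]. *)
have Pu : P ^t* \is unitarymx by rewrite trmxC_unitary spectral_unitarymx.
pose w (a t : T) := (P ^t*) (enum_rank a) (enum_rank t).
pose h (t : T) := complex.Re (sp 0 (enum_rank t)).
have wP : mxof w = P ^t*.
  by apply/matrixP => i j; rewrite mxE /w !enum_valK.
exists w, h; split.
  have [W1 W2] := unitarymx_orthobasis Pu.
  split=> s t; rewrite -sum_enum_val /w.
    under eq_bigr => i _ do rewrite !enum_valK.
    by rewrite W1 (inj_eq enum_rank_inj).
  under eq_bigr => i _ do rewrite !enum_valK.
  by rewrite W2 (inj_eq enum_rank_inj).
rewrite specop_diag wP trmxCK.
have /orthomx_spectralP {1}-> := hermitian_normalmx Ah.
rewrite (invmx_unitary (spectral_unitarymx A)); congr (_ *m diag_mx _ *m _).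
apply/rowP => i; rewrite mxE /h enum_valK RRe_real //.
by have /mxOverP := hermitian_spectral_diag_real Ah; apply.
Qed.

End Entropy.

(** * Typical sequences *)

Section Typicality.
Variable R : realType.

(* For [tau = 0] the bound is [x / 0 = 0]: the event then has probability zero. *)
Lemma chebyshev_degenerate n (T : finType) (w g : T -> R) (tau : R) :
  \sum_t w t = 1 -> (forall t, 0 <= w t) -> \sum_t w t * g t = 0 -> 0 <= tau ->
  (tau = 0 -> forall t, w t != 0 -> g t = 0) -> (0 < n)%N ->
  \sum_(s : {ffun 'I_n -> T} | n%:R * tau < `|\sum_i g (s i)|) \prod_i w (s i)
  <= (\sum_t w t * g t ^+ 2) / tau ^+ 2 / n%:R.
Proof.
move=> w1 w0 g0; rewrite le_eqVlt eq_sym => /orP[/eqP-> /(_ erefl) gz n0|tau0 _ n0]; last first.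
  have cO : #|'I_n| = n by rewrite card_ord.
  by rewrite -[X in X%:R]cO; apply: chebyshev; rewrite ?cO.
rewrite expr0n /= invr0 !mulr0 mul0r big1 // => s; rewrite normr_gt0 => sN.
apply/eqP; apply: contraNT sN => /prodf_neq0 ws.
by rewrite big1 // => i _; apply: gz; apply: ws.
Qed.

Lemma union_bound_fin (T J : finType) (Q : pred T) (B : J -> pred T) (F : T -> R) :
  (forall t, 0 <= F t) -> (forall t, Q t -> exists j, B j t) ->
  \sum_(t | Q t) F t <= \sum_j \sum_(t | B j t) F t.
Proof.
move=> F0 QB; under [leRHS]eq_bigr => j _ do rewrite big_mkcond.
rewrite exchange_big /= big_mkcond; apply: ler_sum => t _.
case: ifP => [/QB[j Bj]|_]; last by apply: sumr_ge0 => j _; case: ifP.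
by rewrite (bigD1 j) //= Bj lerDl; apply: sumr_ge0 => k _; case: ifP.
Qed.

Lemma xlog2xE (t : R) : xlog2x t = t * log2 t.
Proof. by rewrite /xlog2x; case: eqP => [->|]; rewrite ?mul0r. Qed.

Lemma log2_le0 (t : R) : t <= 1 -> log2 t <= 0.
Proof.
move=> t1; rewrite /log2 pmulr_lle0 ?ln_le0 // invr_gt0 ln_gt0 //.
by rewrite ltr1n.
Qed.

Lemma powR2_log2 (t : R) : 0 < t -> 2 `^ (log2 t) = t.
Proof.
move=> t0; have l2 : 0 < ln (2 : R) by rewrite ln_gt0 // ltr1n.
by rewrite /powR gt_eqF // /log2 divfK ?gt_eqF // lnK.
Qed.

Lemma ltr_powR2 (x y : R) : (2 `^ x < 2 `^ y) = (x < y).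
Proof.
have l2 : 0 < ln (2 : R) by rewrite ln_gt0 // ltr1n.
by rewrite /powR gt_eqF // ltr_expR ltr_pM2r.
Qed.

Lemma ler_powR2 (x y : R) : (2 `^ x <= 2 `^ y) = (x <= y).
Proof. by rewrite leNgt ltr_powR2 -leNgt. Qed.

Lemma log2_prod (I : finType) (F : I -> R) : (forall i, 0 < F i) ->
  log2 (\prod_i F i) = \sum_i log2 (F i).
Proof.
move=> F0; have [_ ->] : 0 < \prod_i F i /\ log2 (\prod_i F i) = \sum_i log2 (F i).
  elim/big_ind2: _ => [|x a y b [x0 <-] [y0 <-]|i _]; split=> //.
    by rewrite /log2 ln1 mul0r.
  by rewrite mulr_gt0.
  by rewrite /log2 lnM ?posrE // mulrDl.
by [].
Qed.

Lemma weight_le1 (T : finType) (w : T -> R) t :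
  (forall t, 0 <= w t) -> \sum_t w t = 1 -> w t <= 1.
Proof. by move=> w0 <-; rewrite (bigD1 t) //= lerDl sumr_ge0. Qed.

Lemma shannon_ge0 (T : finType) (w : T -> R) :
  (forall t, 0 <= w t) -> \sum_t w t = 1 -> 0 <= shannon w.
Proof.
move=> w0 w1; rewrite /shannon oppr_ge0; apply: sumr_le0 => t _.
by rewrite xlog2xE mulr_ge0_le0 // log2_le0 // weight_le1.
Qed.

(** Chebyshev for the letter function [log2 (l t) + shannon l], which is centred by the definition
    of entropy: a sequence that is too likely makes its sum exceed [n * c]. *)
Lemma entropy_typical n (T : finType) (l : T -> R) (c : R) :
  (forall t, 0 <= l t) -> \sum_t l t = 1 -> 0 < c -> (0 < n)%N ->
  \sum_(s : {ffun 'I_n -> T} | 2 `^ (- (n%:R * (shannon l - c))) < \prod_k l (s k))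
     \prod_k l (s k)
  <= (\sum_t l t * (log2 (l t) + shannon l) ^+ 2) / c ^+ 2 / n%:R.
Proof.
move=> l0 l1 c0 n0; set g := fun t => log2 (l t) + shannon l.
have g0 : \sum_t l t * g t = 0.
  under eq_bigr do rewrite mulrDr -xlog2xE.
  by rewrite big_split /= -mulr_suml l1 mul1r /shannon subrr.
apply: le_trans (chebyshev_degenerate l1 l0 g0 (ltW c0) _ n0); last first.
  by move=> c00; rewrite c00 ltxx in c0.
rewrite big_mkcond [leRHS]big_mkcond; apply: ler_sum => s _.
case: ifP => [lt_s|_]; last by case: ifP => // _; apply: prodr_ge0.
rewrite ifT //; apply: lt_le_trans (ler_norm _).
have lp : 0 < \prod_k l (s k) by apply: lt_trans lt_s; rewrite powR_gt0.
(* A strictly positive product has no zero letter, so its logarithm is the sum of the logarithms. *)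
have lk k : 0 < l (s k).
  rewrite lt_def l0 andbT; apply: contraTneq lp => lk0.
  by rewrite (bigD1 k) //= lk0 mul0r ltxx.
move: lt_s; rewrite -{1}(powR2_log2 lp) ltr_powR2 log2_prod //.
by rewrite big_split /= sumr_const card_ord -mulr_natl; lra.
Qed.

(** * Conditional typicality: probability and number of sequences *)

Section Conditional.
Variables (X : finType) (d n : nat) (p : X -> R) (q : X -> 'I_d -> R) (delta : R).
Hypotheses (p_ge0 : forall x, 0 <= p x) (p_sum : \sum_x p x = 1).
Hypotheses (q_ge0 : forall x t, 0 <= q x t) (q_sum : forall x, \sum_t q x t = 1).
Hypotheses (delta_gt0 : 0 < delta) (delta_lt1 : delta < 1) (n_gt0 : (0 < n)%N).

Let nR_gt0 : 0 < n%:R :> R. Proof. by rewrite ltr0n. Qed.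

Lemma card_sum (P : pred 'I_n) : (#|[set k | P k]|)%:R = \sum_k (P k)%:R :> R.
Proof. by rewrite -sum1dep_card natr_sum big_mkcond; apply: eq_bigr => k _; case: (P k). Qed.

(** A union bound over letters, with Chebyshev for the centred indicator of each [x] at threshold
    [delta * p x]; a letter with [p x = 0] falls under the degenerate case. *)
Lemma typical_prob :
  \sum_(xn : {ffun 'I_n -> X} | ~~ typical p delta xn) \prod_k p (xn k)
  <= (\sum_x (\sum_t p t * ((t == x)%:R - p x) ^+ 2) / (delta * p x) ^+ 2) / n%:R.
Proof.
rewrite mulr_suml.
apply: le_trans (union_bound_fin (B := fun x (xn : {ffun 'I_n -> X}) =>
   n%:R * (delta * p x) < `|\sum_k ((xn k == x)%:R - p x)|) _ _) _.
- by move=> xn; apply: prodr_ge0.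
- move=> xn /forallPn[x]; rewrite -ltNge => Hx; exists x.
  have -> : \sum_k ((xn k == x)%:R - p x) = n%:R * ((Nocc xn x)%:R / n%:R - p x).
    rewrite sumrB sumr_const card_ord -[p x *+ n]mulr_natl mulrBr [n%:R * (_ / _)]mulrC divfK ?gt_eqF //.
    by rewrite /Nocc card_sum.
  by rewrite normrM gtr0_norm // ltr_pM2l.
apply: ler_sum => x _.
apply: (@chebyshev_degenerate n X p (fun t => (t == x)%:R - p x)) => //.
- under eq_bigr do rewrite mulrBr.
  rewrite sumrB -mulr_suml p_sum mul1r (bigD1 x) //= eqxx mulr1 big1 ?addr0 ?subrr //.
  by move=> t /negPf->; rewrite mulr0.
- by rewrite mulr_ge0 // ltW.
move/eqP; rewrite mulf_eq0 gt_eqF //= => /eqP px t; rewrite px subr0.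
by have [->|] := eqVneq t x; rewrite ?px ?eqxx.
Qed.

Lemma typical_lower (xn : {ffun 'I_n -> X}) x : typical p delta xn ->
  n%:R * ((1 - delta) * p x) <= (Nocc xn x)%:R.
Proof.
move=> /forallP/(_ x); rewrite ler_distl => /andP[+ _].
by rewrite ler_pdivlMr // => h; apply: le_trans h; lra.
Qed.

Lemma typical_upper (xn : {ffun 'I_n -> X}) x : typical p delta xn ->
  (Nocc xn x)%:R <= n%:R * ((1 + delta) * p x).
Proof.
move=> /forallP/(_ x); rewrite ler_distl => /andP[_].
by rewrite ler_pdivrMr // => h; apply: (le_trans h); lra.
Qed.

Lemma sum_ffun_pair (F : {ffun 'I_n -> X} -> {ffun 'I_n -> 'I_d} -> R) :
  \sum_xn \sum_s F xn s
  = \sum_(z : {ffun 'I_n -> X * 'I_d}) F [ffun k => (z k).1] [ffun k => (z k).2].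
Proof.
rewrite pair_bigA /= (reindex (fun z : {ffun 'I_n -> X * 'I_d} =>
  ([ffun k => (z k).1], [ffun k => (z k).2]))) //=.
exists (fun u : {ffun 'I_n -> X} * {ffun 'I_n -> 'I_d} => [ffun k => (u.1 k, u.2 k)]) => [z _|[xn s] _].
  by apply/ffunP => k; rewrite !ffunE; case: (z k).
by congr (_, _); apply/ffunP => k; rewrite !ffunE.
Qed.

(** The sum over pairs [u = (x, t)] of the Chebyshev constants. The factor [(1 - delta) * p x] in
    the threshold is the least frequency of [x] in a typical sequence. *)
Definition cond_typical_const : R :=
  \sum_(u : X * 'I_d) (\sum_(z : X * 'I_d) p z.1 * q z.1 z.2 *
     ((z.1 == u.1)%:R * ((z.2 == u.2)%:R - q u.1 u.2)) ^+ 2)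
     / (delta * q u.1 u.2 * ((1 - delta) * p u.1)) ^+ 2.

(** The number of positions carrying [x] is random, so instead of conditioning on it the pairs
    [(x_k, s_k)] are treated as independent letters of weight [p * q]. For each [(x, t)] the
    deviation is a sum of centred letter functions, and typicality of [xn] converts the threshold
    relative to [Nocc xn x] into one relative to [n]. *)
Lemma cond_typical_prob :
  \sum_(xn : {ffun 'I_n -> X}) \sum_(s : nbasis n d | typical p delta xn && ~~ cond_typical q delta xn s)
     (\prod_k p (xn k)) * \prod_k q (xn k) (s k)
  <= cond_typical_const / n%:R.
Proof.
under eq_bigr do rewrite big_mkcond.
rewrite sum_ffun_pair -big_mkcond /= /cond_typical_const mulr_suml.
under eq_bigr do rewrite -big_split /=.
pose w (z : X * 'I_d) := p z.1 * q z.1 z.2.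
pose g (u z : X * 'I_d) : R := (z.1 == u.1)%:R * ((z.2 == u.2)%:R - q u.1 u.2).
have w_ge0 z : 0 <= w z by rewrite mulr_ge0.
have -> (Q : pred {ffun 'I_n -> X * 'I_d}) :
    \sum_(z : {ffun 'I_n -> X * 'I_d} | Q z) \prod_(k < n)
       (p ([ffun k => (z k).1] k) * q ([ffun k => (z k).1] k) ([ffun k => (z k).2] k))
    = \sum_(z | Q z) \prod_k w (z k).
  by apply: eq_bigr => z _; apply: eq_bigr => k _; rewrite !ffunE.
apply: le_trans (union_bound_fin (B := fun u (z : {ffun 'I_n -> X * 'I_d}) =>
   n%:R * (delta * q u.1 u.2 * ((1 - delta) * p u.1)) < `|\sum_k g u (z k)|) _ _) _.
- by move=> z; apply: prodr_ge0.
- move=> z /andP[typ /forallPn[x /forallPn[t]]]; rewrite -ltNge => Hxt.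
  exists (x, t) => /=; set xn := [ffun k => (z k).1] in typ Hxt.
  have -> : \sum_k g (x, t) (z k) =
     (#|[set k | (xn k == x) && ([ffun k => (z k).2] k == t)]|)%:R - (Nocc xn x)%:R * q x t.
    rewrite /Nocc !card_sum mulr_suml -sumrB; apply: eq_bigr => k _.
    by rewrite !ffunE /g /= -mulnb natrM mulrBr.
  apply: le_lt_trans Hxt; rewrite mulrCA ler_wpM2l ?typical_lower //.
  by rewrite mulr_ge0 // ltW.
apply: ler_sum => u _.
apply: (@chebyshev_degenerate n _ w (g u)) => //.
- rewrite -(pair_bigA _ (fun x t => p x * q x t)) /= -p_sum.
  by apply: eq_bigr => x _; rewrite -mulr_sumr q_sum mulr1.
- rewrite -(pair_bigA _ (fun x t => p x * q x t * ((x == u.1)%:R * ((t == u.2)%:R - q u.1 u.2)))) /=.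
  rewrite (bigD1 u.1) //= [X in _ + X]big1 ?addr0 => [|x /negPf ne]; last first.
    by apply: big1 => t _; rewrite ne mul0r mulr0.
  under eq_bigr => t _ do rewrite eqxx mul1r -mulrA.
  rewrite -mulr_sumr; under eq_bigr => t _ do rewrite mulrBr.
  rewrite sumrB -mulr_suml q_sum mul1r (bigD1 u.2) //= eqxx mulr1 big1 ?addr0 ?subrr ?mulr0 //.
  by move=> t /negPf->; rewrite mulr0.
- by rewrite !mulr_ge0 ?subr_ge0 // ltW.
(* A zero threshold means [p x = 0] or [q x t = 0]. A pair of positive weight with first letter [x]
   excludes the former, and then its label differs from [t], so [g] vanishes on it. *)
move/eqP; rewrite !mulf_eq0 subr_eq0 (gt_eqF delta_gt0) (gt_eqF delta_lt1) /=.
case: u => x t /= pq0 [y s]; rewrite /w /g /= mulf_eq0 negb_or => /andP[py qs].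
have [yx|_] := eqVneq y x; last by rewrite mul0r.
subst y; rewrite (negPf py) orbF in pq0; rewrite mul1r (eqP pq0).
have [st|_] := eqVneq s t; last by rewrite subr0.
by rewrite st pq0 in qs.
Qed.

(** Logarithms of the [q x t] are nonpositive, so upper bounds on the counts give a lower bound on
    the weight. One factor [1 + delta] comes from the typicality of [xn], the other from that of [s]
    given [xn]. *)
Lemma cond_typical_weight (xn : {ffun 'I_n -> X}) (s : nbasis n d) :
  typical p delta xn -> cond_typical q delta xn s ->
  2 `^ (- (n%:R * ((1 + delta) ^+ 2 * \sum_x p x * shannon (q x))))
  <= \prod_k q (xn k) (s k).
Proof.
move=> typ /forallP ctyp.
pose N x t : R := (#|[set k | (xn k == x) && (s k == t)]|)%:R.
have N_le x t : N x t <= (1 + delta) ^+ 2 * (p x * q x t) * n%:R.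
  have /forallP/(_ t) := ctyp x; rewrite ler_distl => /andP[_ h].
  apply: le_trans (_ : (1 + delta) * q x t * (Nocc xn x)%:R <= _); first by apply: (le_trans h); lra.
  have -> : (1 + delta) ^+ 2 * (p x * q x t) * n%:R
     = (1 + delta) * q x t * (n%:R * ((1 + delta) * p x)) by ring.
  by rewrite ler_wpM2l ?typical_upper // mulr_ge0 // addr_ge0 // ltW.
(* A label of probability zero would have count at most 0, yet position [k] contributes to its
   count. *)
have q_gt0 k : 0 < q (xn k) (s k).
  rewrite lt_def q_ge0 andbT; apply/eqP => q0.
  have := N_le (xn k) (s k); rewrite q0 !mulr0 mul0r leNgt ltr0n card_gt0.
  by case/negP; apply/set0Pn; exists k; rewrite inE !eqxx.
have prod_gt0 : 0 < \prod_k q (xn k) (s k) by apply: prodr_gt0.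
rewrite -[leRHS]powR2_log2 // ler_powR2 log2_prod //.
have -> : \sum_k log2 (q (xn k) (s k)) = \sum_x \sum_t N x t * log2 (q x t).
  transitivity (\sum_k \sum_x \sum_t ((xn k == x) && (s k == t))%:R * log2 (q x t)).
    apply: eq_bigr => k _; rewrite (bigD1 (xn k)) //= [X in _ + X]big1 ?addr0.
      rewrite (bigD1 (s k)) //= !eqxx mul1r big1 ?addr0 // => t /negPf ne.
      by rewrite eq_sym ne mul0r.
    by move=> x /negPf ne; apply: big1 => t _; rewrite eq_sym ne mul0r.
  rewrite exchange_big; apply: eq_bigr => x _ /=; rewrite exchange_big.
  by apply: eq_bigr => t _; rewrite /N card_sum mulr_suml.
rewrite mulr_sumr mulr_sumr -sumrN; apply: ler_sum => x _.
rewrite /shannon mulrN !mulrN opprK !mulr_sumr; apply: ler_sum => t _.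
rewrite xlog2xE.
have := ler_wnM2r (log2_le0 (weight_le1 t (q_ge0 x) (q_sum x))) (N_le x t).
by apply: le_trans; rewrite le_eqVlt; apply/orP; left; apply/eqP; ring.
Qed.

(** The weights sum to 1 and each conditionally typical sequence has weight at least the inverse of
    the bound. *)
Lemma cond_typical_card (xn : {ffun 'I_n -> X}) : typical p delta xn ->
  (#|[set s : nbasis n d | cond_typical q delta xn s]|)%:R
  <= 2 `^ (n%:R * ((1 + delta) ^+ 2 * \sum_x p x * shannon (q x))).
Proof.
move=> typ; set e := n%:R * _.
have e0 : 0 < 2 `^ e :> R by rewrite powR_gt0.
rewrite -[leRHS]mul1r -ler_pdivrMr // -powRN.
have S1 : \sum_(s : {ffun 'I_n -> 'I_d}) \prod_k q (xn k) (s k) = 1.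
  by rewrite (sum_prod_ffun (fun k => q (xn k))) big1.
rewrite -[leRHS]S1 -sum1dep_card natr_sum mulr_suml big_mkcond; apply: ler_sum => s _.
case: ifP => [cs|_]; last by apply: prodr_ge0.
by rewrite mul1r; apply: cond_typical_weight.
Qed.

End Conditional.
End Typicality.

(** * Random coding *)

Section RandomCode.
Variables (R : realType) (Y : finType) (D m : nat) (w : Y -> R).
Local Notation C := R[i].
Variables (P : Y -> 'M[C]_D) (S : Y -> 'M[C]_(D, m)) (E : 'M[C]_D).
Hypotheses (w_ge0 : forall y, 0 <= w y) (w_sum : \sum_y w y = 1).
Hypotheses (P_proj : forall y, is_proj (P y)) (E_proj : is_proj E).
Hypothesis S_norm : forall y, hsnorm (S y) = 1.

Lemma seq_dec_probE M (Q : 'I_M -> 'M[C]_D) (T : 'M[C]_(D, m)) k :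
  seq_dec_prob Q (T *m T ^t*) k =
  hsnorm (Q k *m foldr (fun j A => A *m (1%:M - Q j)) 1%:M
                   [seq j : 'I_M <- enum 'I_M | (j < k)%N] *m T).
Proof. by rewrite /seq_dec_prob /hsnorm [in RHS]adj_mul !mulmxA. Qed.

(** For each message, the two miss terms involve one codeword and the confusion terms two codewords
    with different indices, since only earlier messages are tested. The one- and two-coordinate
    marginals then evaluate all averages. *)
Lemma random_code_error (M : nat) (a al be ga : R) : 0 < a ->
  \sum_y w y * hsnorm ((1%:M - E) *m S y) <= al ->
  \sum_y w y * hsnorm ((1%:M - P y) *m S y) <= be ->
  \sum_x \sum_y w x * w y * hsnorm (P x *m (E *m S y)) <= ga ->
  \sum_(c : {ffun 'I_M -> Y}) (\prod_k w (c k)) *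
    (M%:R^-1 * \sum_k (1 - seq_dec_prob (fun j => P (c j)) (S (c k) *m (S (c k)) ^t*) k))
  <= a + (1 + a^-1) * (12 * al + 4 * be + 2 * (M%:R * ga)).
Proof.
have mean_affine (T : finType) (W x y z : T -> R) (K : R) : \sum_t W t = 1 ->
    \sum_t W t * (a + K * (12 * x t + 4 * y t + 2 * z t)) = a + K *
      (12 * (\sum_t W t * x t) + 4 * (\sum_t W t * y t) + 2 * (\sum_t W t * z t)).
  move=> W1; rewrite -[a in RHS]mul1r -W1 mulr_suml !mulr_sumr -!big_split mulr_sumr.
  by rewrite -big_split; apply: eq_bigr => t _ /=; ring.
move=> a0 alP beP gaP.
have wsum0 (f : Y -> R) : (forall y, 0 <= f y) -> 0 <= \sum_y w y * f y.
  by move=> f0; apply: sumr_ge0 => y _; exact: mulr_ge0.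
have al0 : 0 <= al := le_trans (wsum0 _ (fun y => hsnorm_ge0 _)) alP.
have be0 : 0 <= be := le_trans (wsum0 _ (fun y => hsnorm_ge0 _)) beP.
have ga0 : 0 <= ga.
  apply: le_trans gaP; apply: sumr_ge0 => x _; apply: sumr_ge0 => y _.
  exact: mulr_ge0 (mulr_ge0 (w_ge0 x) (w_ge0 y)) (hsnorm_ge0 _).
have K0 : 0 <= 1 + a^-1 by rewrite addr_ge0 // invr_ge0 ltW.
set B := a + _.
have B0 : 0 <= B := addr_ge0 (ltW a0) (mulr_ge0 K0 (addr_ge0
  (addr_ge0 (mulr_ge0 (ler0n R 12) al0) (mulr_ge0 (ler0n R 4) be0))
  (mulr_ge0 (ler0n R 2) (mulr_ge0 (ler0n R M) ga0)))).
pose err (c : {ffun 'I_M -> Y}) k :=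
  1 - seq_dec_prob (fun j => P (c j)) (S (c k) *m (S (c k)) ^t*) k.
have message_error k : \sum_(c : {ffun 'I_M -> Y}) (\prod_j w (c j)) * err c k <= B.
  set l := [seq j : 'I_M <- enum 'I_M | (j < k)%N].
  apply: (@le_trans _ _ (\sum_(c : {ffun 'I_M -> Y}) (\prod_j w (c j)) *
     (a + (1 + a^-1) * (12 * hsnorm ((1%:M - E) *m S (c k))
       + 4 * hsnorm ((1%:M - P (c k)) *m S (c k))
       + 2 * \sum_(j <- l) hsnorm (P (c j) *m (E *m S (c k))))))).
    apply: ler_sum => c _; apply: ler_wpM2l; first exact: prodr_ge0.
    rewrite /err seq_dec_probE.
    exact: (sequential_error (fun j => P_proj (c j)) k l E_proj a0 (S_norm (c k))).
  rewrite mean_affine ?(sum_prod_weight _ w_sum) //.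
  rewrite lerD2l; apply: ler_wpM2l K0 _ _ _.
  apply: lerD; first apply: lerD; apply: ler_wpM2l (ler0n _ _) _ _ _.
  - by rewrite (marginal1 w_sum k (fun y => hsnorm ((1%:M - E) *m S y))).
  - by rewrite (marginal1 w_sum k (fun y => hsnorm ((1%:M - P y) *m S y))).
  under eq_bigr do rewrite mulr_sumr.
  rewrite exchange_big /=.
  apply: (@le_trans _ _ (\sum_(j <- l) ga)).
    rewrite /l !big_filter; apply: ler_sum => j jk.
    rewrite (marginal2 w_sum (fun x y => hsnorm (P x *m (E *m S y)))) //.
    by rewrite -val_eqE (ltn_eqF jk).
  (* The number of earlier messages is bounded by [M], whatever [k] is. *)
  rewrite /l big_filter big_enum_cond /=.
  apply: (@le_trans _ _ (\sum_(j < M) ga)).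
    by rewrite big_mkcond; apply: ler_sum => j _; case: ifP.
  by rewrite sumr_const card_ord mulr_natl.
rewrite (_ : \sum_c _ = M%:R^-1 * \sum_k \sum_(c : {ffun 'I_M -> Y}) (\prod_j w (c j)) * err c k);
  last first.
  rewrite exchange_big mulr_sumr; apply: eq_bigr => c _.
  by rewrite mulrCA mulr_sumr.
apply: (@le_trans _ _ (M%:R^-1 * (M%:R * B))).
  rewrite ler_wpM2l ?invr_ge0 //.
  have -> : M%:R * B = \sum_(k < M) B by rewrite sumr_const card_ord mulr_natl.
  exact: ler_sum.
(* Without messages [M%:R^-1] is 0 and the claim reduces to [B0]; this occurs for negative rates. *)
case: (posnP M) => [->|M0]; first by rewrite invr0 mul0r.
by rewrite mulKf // pnatr_eq0 -lt0n.
Qed.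
End RandomCode.

(** * Spectra of the channel states and the Holevo form of the mutual information *)

Section Channel.
Variables (R : realType) (X : finType) (d : nat).
Local Notation C := R[i].
Local Notation "x %:C" := (real_complex R x).
Variables (rho : X -> 'M[C]_d) (p : X -> R) (U : X -> 'M[C]_d) (q : X -> 'I_d -> R).
Hypothesis rho_density : forall x, is_density (rho x).
Hypothesis U_unitary : forall x, U x \is unitarymx.
Hypothesis rho_diag :
  forall x, rho x = U x *m diag_mx (\row_t ((q x t)%:C)%C) *m (U x) ^t*.
Hypothesis p_ge0 : forall x, 0 <= p x.
Hypothesis p_sum : \sum_x p x = 1.

Lemma U_orthobasis x : orthobasis (U x).
Proof. exact: unitarymx_orthobasis. Qed.

Lemma rhoE x a b : rho x a b = \sum_t (q x t)%:C * (U x a t * (U x b t)^*).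
Proof.
rewrite rho_diag mul_mx_diag !mxE; apply: eq_bigr => t _.
by rewrite !mxE mulrCA mulrA.
Qed.

Lemma q_ge0 x t : 0 <= q x t.
Proof.
have [_ psd _] := rho_density x.
have /unitarymxP/mulmx1C UU := U_unitary x.
have rU : row t ((U x) ^t*) *m U x = 'e_t by rewrite -row_mul UU row1.
have := psd (row t ((U x) ^t*)).
rewrite rho_diag -!mulmxA -adj_mul !mulmxA rU -rowE.
rewrite mxE (bigD1 t) //= big1 => [|s st]; last by rewrite !mxE (negPf st) conjC0 mulr0.
by rewrite !mxE !eqxx mulr1n conjC1 mulr1 addr0 ler0c.
Qed.

Lemma q_sum x : \sum_t q x t = 1.
Proof.
have [_ _] := rho_density x; rewrite rho_diag mxtrace_mulC mulmxA.
have /unitarymxP/mulmx1C -> := U_unitary x.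
rewrite mul1mx mxtrace_diag => /(congr1 (@complex.Re R)); rewrite Re_sum => qE.
rewrite (_ : 1 = complex.Re (1 : C)) // -qE.
by apply: eq_bigr => t _; rewrite mxE.
Qed.

Lemma entry_mxof (T : finType) (f : T -> T -> C) u v : entry (mxof f) u v = f u v.
Proof. by rewrite /entry mxE !enum_rankK. Qed.

Lemma Re_tr_sum (I : finType) n (A : I -> 'M[C]_n) :
  complex.Re (\tr (\sum_i A i)) = \sum_i complex.Re (\tr (A i)).
Proof. by rewrite (raddf_sum (@mxtrace C n)) Re_sum. Qed.

Definition avg_state (a b : 'I_d) : C := \sum_x (p x)%:C * rho x a b.

Lemma ptrA_cq : ptrA (cq_state p rho) = mxof avg_state.
Proof.
apply: eq_mxof => a b; apply: eq_bigr => x _.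
by rewrite entry_mxof /= eqxx.
Qed.

Lemma orthobasis_delta (T : finType) : orthobasis (fun a b : T => (a == b)%:R : C).
Proof.
by split=> s t; rewrite (bigD1 s) //= big1 => [|a /negPf ne];
  rewrite ?eqxx ?conjC1 ?mul1r ?mulr1 ?addr0 // ?(eq_sym t) // ?ne ?(eq_sym s) ?ne
          ?conjC0 ?mul0r ?mulr0 // conjC_nat.
Qed.

Lemma ptrB_cq : ptrB (cq_state p rho) = specop (fun a b : X => (a == b)%:R) p.
Proof.
apply: eq_mxof => x y; under eq_bigr do rewrite entry_mxof /=.
rewrite (bigD1 x) //= [X in _ = _ + X]big1 => [|a /negPf ne]; last first.
  by rewrite eq_sym ne mul0r mulr0.
rewrite eqxx mul1r addr0 conjC_nat eq_sym; case: eqP => _; last by rewrite mulr0 big1.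
rewrite mulr1 -mulr_sumr; have [_ _] := rho_density x; rewrite /mxtrace => ->.
by rewrite mulr1.
Qed.

(** The vector labelled [(x, t)] is the basis vector of [x] tensored with the [t]-th eigenvector of
    [rho x]. *)
Definition cq_basis (u v : X * 'I_d) : C := (u.1 == v.1)%:R * U u.1 u.2 v.2.

Lemma orthobasis_cq : orthobasis cq_basis.
Proof.
split=> -[x s] [y t]; rewrite /cq_basis xpair_eqE -mulnb natrM.
  rewrite -(pair_bigA _ (fun z a => ((z == x)%:R * U z a s)^* * ((z == y)%:R * U z a t))) /=.
  rewrite (bigD1 x) //= [X in _ + X]big1 ?addr0 => [|z /negPf ne]; last first.
    by apply: big1 => a _; rewrite ne mul0r conjC0 mul0r.
  rewrite -(proj1 (U_orthobasis x)) mulr_sumr; apply: eq_bigr => a _.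
  by rewrite eqxx mul1r mulrCA.
rewrite -(pair_bigA _ (fun z a => ((x == z)%:R * U x s a) * ((y == z)%:R * U y t a)^*)) /=.
rewrite (bigD1 x) //= [X in _ + X]big1 ?addr0 => [|z /negPf ne]; last first.
  by apply: big1 => a _; rewrite eq_sym ne !mul0r.
transitivity ((x == y)%:R * \sum_a U x s a * (U y t a)^*).
  rewrite mulr_sumr; apply: eq_bigr => a _.
  by rewrite eqxx mul1r rmorphM /= conjC_nat mulrCA eq_sym.
case: eqP => [->|_]; last by rewrite !mul0r.
by rewrite (proj2 (U_orthobasis y)).
Qed.

Lemma cq_stateE : cq_state p rho = specop cq_basis (fun u => p u.1 * q u.1 u.2).
Proof.
apply: eq_mxof => -[x s] [y t] /=; rewrite /cq_basis.
rewrite -(pair_bigA _ (fun z a => (p z * q z a)%:C *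
   (((x == z)%:R * U x s a) * ((y == z)%:R * U y t a)^*))) /=.
rewrite (bigD1 x) //= [X in _ + X]big1 ?addr0 => [|z /negPf ne]; last first.
  by apply: big1 => a _; rewrite eq_sym ne !mul0r mulr0.
rewrite eq_sym; case: eqP => [->|_]; last first.
  by rewrite big1 // => a _; rewrite mul0r conjC0 !mulr0.
rewrite rhoE mulr_sumr; apply: eq_bigr => a _.
by rewrite eqxx !mul1r mulrA -(rmorphM (real_complex R)).
Qed.

Lemma xlog2xM (a b : R) : 0 <= a -> 0 <= b ->
  xlog2x (a * b) = b * xlog2x a + a * xlog2x b.
Proof.
rewrite /xlog2x mulf_eq0 !le_eqVlt !(eq_sym 0).
case: eqP => [-> _ _|_ /= a0]; first by rewrite /= ?mulr0 !mul0r ?mulr0 addr0.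
case: eqP => [-> _|_ /= b0]; first by rewrite /= ?mulr0 !mul0r ?mulr0 addr0.
by rewrite /log2 lnM ?posrE //; ring.
Qed.

Lemma avg_state_specop : exists (v : 'I_d -> 'I_d -> C) (l : 'I_d -> R),
  orthobasis v /\ mxof avg_state = specop v l.
Proof.
apply/hermitian_specop/is_hermitianmxP; rewrite expr0 scale1r mxof_adj.
apply: eq_mxof => a b; rewrite rmorph_sum; apply: eq_bigr => x _.
rewrite rmorphM /=; congr (_ * _); first by rewrite [RHS](conjc_real (p x)).
have [/is_hermitianmxP rh _ _] := rho_density x.
by rewrite {1}rh expr0 scale1r !mxE.
Qed.

(** Each [l t] is the trace of the average state against the projector on one eigenvector, hence a
    [p]-average of nonnegative numbers; the sum of the [l t] is the trace. *)
Lemma avg_spectrum (v : 'I_d -> 'I_d -> C) (l : 'I_d -> R) :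
  orthobasis v -> mxof avg_state = specop v l -> (forall t, 0 <= l t) /\ \sum_t l t = 1.
Proof.
move=> vON vl; have avgE : mxof avg_state = \sum_x (p x)%:C *: specop (U x) (q x).
  apply/matrixP => i j; rewrite summxE !mxE; apply: eq_bigr => x _.
  by rewrite !mxE rhoE.
split=> [t|]; last first.
  transitivity (complex.Re (\tr (mxof avg_state))); first by rewrite vl specop_tr.
  rewrite avgE Re_tr_sum -p_sum; apply: eq_bigr => x _.
  rewrite /= mxtraceZ Re_scale specop_tr ?q_sum ?mulr1 //; exact: U_orthobasis.
pose E := specop v (fun s => (pred1 t s)%:R).
have -> : l t = complex.Re (\tr (E *m mxof avg_state)).
  rewrite vl specop_mul // specop_tr //= (bigD1 t) //= eqxx mul1r big1 ?addr0 //.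
  by move=> s /negPf->; rewrite mul0r.
rewrite avgE mulmx_sumr Re_tr_sum; apply: sumr_ge0 => x _.
rewrite /= -scalemxAr mxtraceZ Re_scale mulr_ge0 //.
have q0 := q_ge0 x; have UON := U_orthobasis x.
by rewrite -(specop_sqrt UON q0) -hsnorm_proj ?hsnorm_ge0 //; exact: specop_proj.
Qed.

(** The spectrum of the cq state is the joint distribution [p x * q x t]. By the chain rule its
    entropy contains [shannon p], which cancels against the entropy of the first marginal. *)
Lemma qmutinf_holevo (v : 'I_d -> 'I_d -> C) (l : 'I_d -> R) :
  orthobasis v -> mxof avg_state = specop v l ->
  qmutinf (cq_state p rho) = shannon l - \sum_x p x * shannon (q x).
Proof.
move=> vON vl; rewrite /qmutinf ptrB_cq ptrA_cq vl cq_stateE.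
rewrite !vN_entropy_specop //; [|exact: orthobasis_cq|exact: orthobasis_delta].
have -> : shannon (fun u : X * 'I_d => p u.1 * q u.1 u.2)
        = shannon p + \sum_x p x * shannon (q x).
  rewrite /shannon -(pair_bigA _ (fun x t => xlog2x (p x * q x t))) /=.
  rewrite -!sumrN -big_split /=; apply: eq_bigr => x _.
  rewrite mulrN -opprD; congr (- _).
  under eq_bigr do rewrite xlog2xM // ?q_ge0 //.
  by rewrite big_split /= -mulr_suml q_sum mul1r mulr_sumr.
by rewrite opprD addrAC addrA subrr add0r addrC.
Qed.

(** * Block states and decoding projectors in their product eigenbasis *)

Section Blocks.
Variables (n : nat) (delta : R).
Local Notation Y := {ffun 'I_n -> X}.

Definition block_basis (xn : Y) (a s : nbasis n d) : C := \prod_k U (xn k) (a k) (s k).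
Definition block_weight (xn : Y) (s : nbasis n d) : R := \prod_k q (xn k) (s k).
Definition block_prob (xn : Y) : R := \prod_k p (xn k).

Lemma orthobasis_block xn : orthobasis (block_basis xn).
Proof. by apply: (orthobasis_prod (u := fun k => U (xn k))) => k; exact: U_orthobasis. Qed.

Lemma block_weight_ge0 xn s : 0 <= block_weight xn s.
Proof. by apply: prodr_ge0 => k _; exact: q_ge0. Qed.

Lemma block_weight_sum xn : \sum_s block_weight xn s = 1.
Proof.
rewrite (sum_prod_ffun (fun k => q (xn k))) big1 // => k _; exact: q_sum.
Qed.

Lemma block_prob_ge0 xn : 0 <= block_prob xn.
Proof. exact: prodr_ge0. Qed.

Lemma block_prob_sum : \sum_xn block_prob xn = 1.
Proof. exact: sum_prod_weight. Qed.

Lemma prod_stateE (xn : Y) : prod_state rho xn = specop (block_basis xn) (block_weight xn).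
Proof.
rewrite -(specop_prod (fun k => U (xn k)) (fun k => q (xn k))).
by apply: eq_mxof => a b; apply: eq_bigr => k _; rewrite rhoE.
Qed.

Definition block_sqrt (xn : Y) := specop (block_basis xn) (fun s => Num.sqrt (block_weight xn s)).

Lemma prod_state_sqrt (xn : Y) : prod_state rho xn = block_sqrt xn *m (block_sqrt xn) ^t*.
Proof.
by rewrite prod_stateE specop_sqrt //; [exact: orthobasis_block|exact: block_weight_ge0].
Qed.

Lemma hsnorm_block_sqrt xn : hsnorm (block_sqrt xn) = 1.
Proof.
rewrite /hsnorm -prod_state_sqrt prod_stateE specop_tr ?block_weight_sum //.
exact: orthobasis_block.
Qed.

Definition accepted (xn : Y) (s : nbasis n d) : bool :=
  typical p delta xn && cond_typical q delta xn s.

Lemma dec_projE (xn : Y) :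
  dec_proj p U q delta xn = specop (block_basis xn) (fun s => (accepted xn s)%:R).
Proof.
rewrite /dec_proj /accepted; case: (typical p delta xn) => /=; last first.
  by apply/matrixP => i j; rewrite !mxE big1 // => s _; rewrite mul0r.
apply: eq_mxof => a b; rewrite big_mkcond; apply: eq_bigr => s _ /=.
rewrite /block_basis conj_prod -big_split /=.
by case: (cond_typical q delta xn s); rewrite ?mul1r ?mul0r.
Qed.

Lemma is_proj_dec (xn : Y) : is_proj (dec_proj p U q delta xn).
Proof. rewrite dec_projE; apply: specop_proj; exact: orthobasis_block. Qed.

(** State and projector are diagonal in the same basis, so the probability of rejection is a
    classical one. *)
Lemma dec_proj_miss (xn : Y) :
  hsnorm ((1%:M - dec_proj p U q delta xn) *m block_sqrt xn)
  = \sum_(s | ~~ accepted xn s) block_weight xn s.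
Proof.
have bON := orthobasis_block xn.
rewrite hsnorm_proj; last exact/is_projC/is_proj_dec.
rewrite -prod_state_sqrt prod_stateE dec_projE -(specop1 bON) specopB specop_mul //.
rewrite specop_tr //= [RHS]big_mkcond; apply: eq_bigr => s _.
by case: (accepted xn s); rewrite /= ?subrr ?mul0r // subr0 mul1r.
Qed.

Lemma hsnorm_dec_proj_le (xn : Y) : 0 < delta -> (0 < n)%N ->
  hsnorm (dec_proj p U q delta xn)
  <= 2 `^ (n%:R * ((1 + delta) ^+ 2 * \sum_x p x * shannon (q x))).
Proof.
move=> d0 n0; have bON := orthobasis_block xn.
have [Ph Pi] := is_proj_dec xn; rewrite /hsnorm Ph Pi dec_projE specop_tr //= /accepted.
case typ: (typical p delta xn); last by rewrite big1 // powR_ge0.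
apply: le_trans (cond_typical_card q_ge0 q_sum d0 n0 typ).
by rewrite -sum1dep_card natr_sum [leRHS]big_mkcond ler_sum // => s _ /=; case: ifP.
Qed.

(** An atypical codeword is rejected with its whole unit mass, a typical one with the mass of its
    conditionally atypical labels. *)
Lemma dec_proj_miss_avg : 0 < delta -> delta < 1 -> (0 < n)%N ->
  \sum_xn block_prob xn * hsnorm ((1%:M - dec_proj p U q delta xn) *m block_sqrt xn)
  <= ((\sum_x (\sum_t p t * ((t == x)%:R - p x) ^+ 2) / (delta * p x) ^+ 2)
      + cond_typical_const p q delta) / n%:R.
Proof.
move=> d0 d1 n0; rewrite mulrDl.
apply: le_trans (lerD (typical_prob p_ge0 p_sum d0 n0)
  (cond_typical_prob p_ge0 p_sum q_ge0 q_sum d0 d1 n0)).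
rewrite [X in _ <= X + _]big_mkcond -big_split /=; apply: ler_sum => xn _.
rewrite dec_proj_miss /accepted; case: (typical p delta xn) => /=.
  by rewrite add0r mulr_sumr.
by rewrite block_weight_sum mulr1 [X in _ <= _ + X]big_pred0 ?addr0.
Qed.

(** * Compression to small eigenvalues of the average block state *)

Section Compression.
Variables (v : 'I_d -> 'I_d -> C) (l : 'I_d -> R) (c : R).
Hypotheses (vON : orthobasis v) (vl : mxof avg_state = specop v l).

Let l_ge0 : forall t, 0 <= l t. Proof. by case: (avg_spectrum vON vl). Qed.
Let l_sum : \sum_t l t = 1. Proof. by case: (avg_spectrum vON vl). Qed.

Definition avg_basis (a s : nbasis n d) : C := \prod_k v (a k) (s k).
Definition avg_weight (s : nbasis n d) : R := \prod_k l (s k).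

Lemma orthobasis_avg : orthobasis avg_basis.
Proof. exact: (orthobasis_prod (u := fun=> v)). Qed.

(** Each matrix entry is a sum over codewords of products over positions; it factorizes into entries
    of the one-letter average state. *)
Lemma avg_prod_state :
  \sum_xn (block_prob xn)%:C *: prod_state rho xn = specop avg_basis avg_weight.
Proof.
rewrite -(specop_prod (fun=> v) (fun=> l)).
apply/matrixP => i j; rewrite summxE !mxE.
transitivity (\prod_k avg_state (enum_val i k) (enum_val j k)).
  rewrite /avg_state -(sum_prod_ffun (fun k x =>
    (p x)%:C * rho x (enum_val i k) (enum_val j k))).
  by apply: eq_bigr => xn _; rewrite !mxE big_split /= -real_prod.
apply: eq_bigr => k _.
have /(congr1 (fun A => entry A (enum_val i k) (enum_val j k))) := vl.
by rewrite !entry_mxof.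
Qed.

Lemma avg_Re_tr m (A B : 'M[C]_(m, _)) :
  \sum_xn block_prob xn * complex.Re (\tr (A *m prod_state rho xn *m B ^t*))
  = complex.Re (\tr (A *m specop avg_basis avg_weight *m B ^t*)).
Proof.
rewrite -avg_prod_state mulmx_sumr mulmx_suml Re_tr_sum; apply: eq_bigr => xn _.
by rewrite -scalemxAr -scalemxAl mxtraceZ Re_scale.
Qed.

(** One-sided typicality: only large eigenvalues are removed, because the confusion bound asks only
    for a cap on the compressed average state. *)
Definition low_weight : pred (nbasis n d) :=
  fun s => avg_weight s <= 2 `^ (- (n%:R * (shannon l - c))).

Definition compression := specop avg_basis (fun s => (low_weight s)%:R).

Lemma is_proj_compression : is_proj compression.
Proof. exact: (specop_proj orthobasis_avg). Qed.

Lemma compression_miss_avg : 0 < c -> (0 < n)%N ->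
  \sum_xn block_prob xn * hsnorm ((1%:M - compression) *m block_sqrt xn)
  <= (\sum_t l t * (log2 (l t) + shannon l) ^+ 2) / c ^+ 2 / n%:R.
Proof.
move=> c0 n0; have aON := orthobasis_avg.
have h1 : is_proj (1%:M - compression) by exact/is_projC/is_proj_compression.
under eq_bigr => xn _.
  rewrite hsnorm_proj // -prod_state_sqrt -[_ *m _]mulmx1.
  rewrite -[X in _ *m X](_ : (1%:M) ^t* = 1%:M); last by rewrite trmx1 map_mx1.
  over.
rewrite avg_Re_tr trmx1 map_mx1 mulmx1 /compression -(specop1 aON) specopB specop_mul //.
rewrite specop_tr //=; apply: le_trans (entropy_typical l_ge0 l_sum c0 n0).
rewrite [leRHS]big_mkcond; apply: ler_sum => s _; rewrite /low_weight -/(avg_weight s).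
by case: (leP (avg_weight s)) => _; rewrite /= ?subrr ?subr0 ?mul0r ?mul1r.
Qed.

(** With the tested word [xn] fixed, averaging over the sent word [yn] first replaces its state by
    the average block state. After compression its eigenvalues are at most [L], and the squared norm
    of the projector is its rank, at most [K]. *)
Lemma confusion_avg : (0 < n)%N -> 0 < delta ->
  \sum_xn \sum_yn block_prob xn * block_prob yn *
     hsnorm (dec_proj p U q delta xn *m (compression *m block_sqrt yn))
  <= 2 `^ (- (n%:R * (shannon l - c))) *
     2 `^ (n%:R * ((1 + delta) ^+ 2 * \sum_x p x * shannon (q x))).
Proof.
move=> n0 d0; have aON := orthobasis_avg; have [Eh Ei] := is_proj_compression.
set L := 2 `^ _; set K := 2 `^ _.
have L0 : 0 <= L by rewrite powR_ge0.
apply: (@le_trans _ _ (\sum_xn block_prob xn * (L * K))); last first.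
  by rewrite -mulr_suml block_prob_sum mul1r.
apply: ler_sum => xn _; under eq_bigr do rewrite -mulrA.
rewrite -mulr_sumr ler_wpM2l ?block_prob_ge0 //.
set P := dec_proj p U q delta xn.
apply: (@le_trans _ _ (L * hsnorm P)); last first.
  by apply: ler_wpM2l => //; apply: hsnorm_dec_proj_le.
have e1 yn : hsnorm (P *m (compression *m block_sqrt yn)) =
    complex.Re (\tr (P *m compression *m prod_state rho yn *m (P *m compression) ^t*)).
  by rewrite prod_state_sqrt /hsnorm !adj_mul !mulmxA.
under eq_bigr do rewrite e1.
rewrite avg_Re_tr adj_mul Eh !mulmxA -!(mulmxA P) /compression !specop_mul //.
rewrite mulmxA; apply: Re_tr_specop_le => // s; rewrite mulrAC -natrM mulnb andbb.
case: (boolP (low_weight s)) => [|_]; first by rewrite mul1r.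
by rewrite mul0r.
Qed.

End Compression.
End Blocks.

Lemma expected_error_le n M (delta a c : R) (v : 'I_d -> 'I_d -> C) (l : 'I_d -> R) :
  orthobasis v -> mxof avg_state = specop v l -> (0 < n)%N ->
  0 < delta -> delta < 1 -> 0 < a -> 0 < c ->
  @expected_error R X d n M p rho U q delta
  <= a + (1 + a^-1) *
    (12 * ((\sum_t l t * (log2 (l t) + shannon l) ^+ 2) / c ^+ 2 / n%:R)
   + 4 * (((\sum_x (\sum_t p t * ((t == x)%:R - p x) ^+ 2) / (delta * p x) ^+ 2)
      + cond_typical_const p q delta) / n%:R)
   + 2 * (M%:R * (2 `^ (- (n%:R * (shannon l - c))) *
     2 `^ (n%:R * ((1 + delta) ^+ 2 * \sum_x p x * shannon (q x)))))).
Proof.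
move=> vON vl n0 d0 d1 a0 c0.
have -> : @expected_error R X d n M p rho U q delta =
    \sum_(cb : {ffun 'I_M -> {ffun 'I_n -> X}}) (\prod_k block_prob (cb k)) *
      (M%:R^-1 * \sum_k (1 - seq_dec_prob (fun j => dec_proj p U q delta (cb j))
         (block_sqrt (cb k) *m (block_sqrt (cb k)) ^t*) k)).
  apply: eq_bigr => cb _; congr (_ * (_ * _)).
  by apply: eq_bigr => k _; rewrite -prod_state_sqrt.
apply: (random_code_error (@block_prob_ge0 n) (block_prob_sum n) (is_proj_dec delta)
   (is_proj_compression n l c vON) (@hsnorm_block_sqrt n) M a0).
- exact: compression_miss_avg.
- exact: dec_proj_miss_avg.
exact: confusion_avg.
Qed.

End Channel.

(** * Choice of parameters *)

Lemma powR2_le_inv (R : realType) (x : R) : 0 < x -> 2 `^ (- x) <= (x * ln 2)^-1.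
Proof.
move=> x0; have l2 : 0 < ln (2 : R) by rewrite ln_gt0 // ltr1n.
have xl : 0 < x * ln 2 by rewrite mulr_gt0.
rewrite powRN lef_pV2 ?posrE ?powR_gt0 // /powR gt_eqF //.
(* From [expR y >= 1 + y] with [y = x * ln 2]. This crude decay suffices, the Chebyshev terms being
   of order [1/n] as well. *)
by apply: le_trans (expR_ge1Dx _); rewrite lerDr.
Qed.

Lemma typicality_slack (R : realType) (H c : R) : 0 <= H -> 0 < c ->
  exists delta, [/\ 0 < delta, delta < 1 / 64 & (1 + delta) ^+ 2 * H <= H + c].
Proof.
move=> H0 c0; have D0 : 0 < 3 * H + 128 * c by lra.
(* With this [e], the summand [128 * c] forces [e < 1/64], and [3 * H] gives
   [(2 * e + e ^+ 2) * H <= 3 * e * H <= c]. *)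
exists (c / (3 * H + 128 * c)); set e := c / _.
have e0 : 0 < e by rewrite divr_gt0.
have eD : e * (3 * H + 128 * c) = c by rewrite /e divfK // gt_eqF.
have e1 : e < 1 / 64 by rewrite /e ltr_pdivrMr //; lra.
split=> //.
have : e ^+ 2 * H <= e * H by rewrite ler_wpM2r // expr2 ler_piMr ?ltW //; lra.
have : 0 <= e * c by rewrite mulr_ge0 // ltW.
by nra.
Qed.

Theorem theorem1 (R : realType) (X : finType) (d : nat)
  (rho : X -> 'M[R[i]]_d) (p : X -> R)
  (U : X -> 'M[R[i]]_d) (q : X -> 'I_d -> R) :
  (forall x, is_density (rho x)) ->
  (forall x, U x \is unitarymx) ->
  (forall x, rho x = U x *m diag_mx (\row_t ((q x t)%:C)%C) *m (U x) ^t*) ->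
  (forall x, 0 <= p x) -> \sum_x p x = 1 ->
  forall (r eta : R), r < qmutinf (cq_state p rho) -> 0 < eta ->
  exists (delta : R) (n : nat),
    [/\ 0 < delta, delta < 1 / 64, (0 < n)%N &
        @expected_error R X d n (Num.truncn (powR 2 (n%:R * r))) p rho U q delta
          <= eta].
Proof.
move=> rhoD UU rhoU p0 p1 r eta.
have [v [l [vON vl]]] := avg_state_specop p rhoD.
rewrite (qmutinf_holevo rhoD UU rhoU p0 vON vl).
set H := shannon l; set Hc := \sum_x _ => rI eta0.
have Hc0 : 0 <= Hc.
  apply: sumr_ge0 => x _; rewrite mulr_ge0 // shannon_ge0 //.
    exact: (q_ge0 rhoD UU rhoU).
  exact: (q_sum rhoD UU rhoU).
(* The gap between capacity and rate is [4 * c]: compression uses one [c], typicality slack another,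
   and the exponent left over is [- 2 * c] per letter. *)
pose c := (H - Hc - r) / 4.
have c0 : 0 < c by rewrite /c; lra.
have [delta [d0 d1 slack]] := typicality_slack Hc0 c0.
have l2 : 0 < ln (2 : R) by rewrite ln_gt0 // ltr1n.
have confusion (n : nat) : (0 < n)%N ->
    (Num.truncn (2 `^ (n%:R * r)))%:R * (2 `^ (- (n%:R * (H - c))) *
       2 `^ (n%:R * ((1 + delta) ^+ 2 * Hc))) <= (2 * c * ln 2)^-1 / n%:R.
  move=> n0; have n0' : 0 < n%:R :> R by rewrite ltr0n.
  have P2 (x : R) : 0 <= 2 `^ x by rewrite powR_ge0.
  apply: (@le_trans _ _ (2 `^ (n%:R * r) * (2 `^ (- (n%:R * (H - c))) *
     2 `^ (n%:R * (Hc + c))))).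
    apply: ler_pM; rewrite ?mulr_ge0 ?truncn_le //.
    by apply: ler_wpM2l => //; rewrite ler_powR2 ler_wpM2l // ltW.
  rewrite -!powRD ?pnatr_eq0 ?implybT //.
  have -> : n%:R * r + (- (n%:R * (H - c)) + n%:R * (Hc + c)) = - (n%:R * (2 * c)).
    by rewrite /c; field.
  have nc0 : 0 < n%:R * (2 * c) by rewrite mulr_gt0 // mulr_gt0 // ltr0n.
  apply: le_trans (powR2_le_inv nc0) _.
  by rewrite -invfM le_eqVlt; apply/orP; left; apply/eqP; congr (_^-1); ring.
set K1 := (\sum_t l t * (log2 (l t) + H) ^+ 2) / c ^+ 2.
set K2 := (\sum_x (\sum_t p t * ((t == x)%:R - p x) ^+ 2) / (delta * p x) ^+ 2)
      + cond_typical_const p q delta.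
(* Half of [eta] pays for the Young weight [a]. The other half bounds all remaining terms, which
   together are at most [K / n] with [K] independent of [n]. *)
pose a := eta / 2; have a0 : 0 < a by rewrite divr_gt0.
pose K := (1 + a^-1) * (12 * K1 + 4 * K2 + 2 * (2 * c * ln 2)^-1).
pose n := (Num.truncn (K / a)).+1.
have nK : K / a < n%:R by apply: real_truncnS_gt; exact: num_real.
have n0 : 0 < n%:R :> R by rewrite ltr0n.
exists delta, n; split=> //.
have d1' : delta < 1 by lra.
apply: le_trans (expected_error_le rhoD UU rhoU p0 p1 _ vON vl (ltn0Sn _) d0 d1' a0 c0) _.
rewrite -/Hc -/H -/K1 -/K2.
have -> : eta = a + a by rewrite /a; field.
rewrite lerD2l; apply: (@le_trans _ _ (K / n%:R)); last first.
  by rewrite ler_pdivrMr // mulrC -ler_pdivrMr // ltW.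
rewrite /K -[leRHS]mulrA; apply: ler_wpM2l; first by rewrite addr_ge0 // invr_ge0 ltW.
have split_n (x y z : R) : (12 * x + 4 * y + 2 * z) / n%:R
   = 12 * (x / n%:R) + 4 * (y / n%:R) + 2 * (z / n%:R) by ring.
by rewrite split_n lerD2l; apply: ler_wpM2l => //; apply: confusion.
Qed.
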